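(* Let $k$ be an algebraically closed field of characteristic $p\ge 7$, and for $\lambda\in k\smallsetminus\{0,1\}$ let $H'_\lambda$ be the genus-$4$ hyperelliptic curve $y^2=(x^5-1)(x^5-\lambda)$ over $k$. For $\lambda_1,\lambda_2\in k\smallsetminus\{0,1\}$, the curve $H'_{\lambda_1}$ is isomorphic to the curve $H'_{\lambda_2}$ if and only if $\lambda_1=\lambda_2$ or $\lambda_1=1/\lambda_2$.
   Context: Curves are non-singular projective and isomorphisms are over the algebraically closed field $k$. *)

(* Defs.v *)
From HB Require Import structures.
From mathcomp Require Import all_boot all_order all_algebra.
From mathcomp Require Import mpoly.
From mathcomp Require Import ring zify.

Set Implicit Arguments.
Unset Strict Implicit.
Unset Printing Implicit Defensive.

Import GRing.Theory.
Local Open Scope ring_scope.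

(* Projective varieties over an algebraically closed field k are seen as sets *)
(* of k-points. A point of P^n is a line of k^(n+1); the nonzero vectors on   *)
(* it are its homogeneous coordinates.                                        *)
Definition projspace (k : fieldType) (n : nat) : Type :=
  {L : {vspace 'rV[k]_n.+1} | \dim L == 1%N}.

Definition homog_coords (k : fieldType) (n : nat)
    (P : projspace k n) (v : 'rV[k]_n.+1) : Prop :=
  v != 0 /\ v \in val P.

Definition projset (k : fieldType) (n : nat) : Type := projspace k n -> Prop.

Definition zero_locus (k : fieldType) (n : nat)
    (S : {mpoly k[n.+1]} -> Prop) : projset k n :=
  fun P => forall F v, S F -> homog_coords P v -> F.@[v 0] = 0.

Definition eval_tuple (k : fieldType) (n m : nat)
    (F : 'I_m.+1 -> {mpoly k[n.+1]}) (v : 'rV[k]_n.+1) : 'rV[k]_m.+1 :=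
  \row_i (F i).@[v 0].

(* A morphism is given, near each point P of X, by forms F_0, ..., F_m of the *)
(* same degree without common zero at P. Asking for agreement with phi on the *)
(* whole of X minus the common zeros of the F_i is not stronger than asking   *)
(* for it on some Zariski neighbourhood of P in X: multiply the F_i by a form *)
(* that is nonzero at P and vanishes on X outside of the neighbourhood.       *)
(* The values of phi outside of X are irrelevant.                             *)
Definition is_morphism (k : fieldType) (n m : nat)
    (X : projset k n) (Y : projset k m)
    (phi : projspace k n -> projspace k m) : Prop :=
  (forall P, X P -> Y (phi P)) /\
  forall P, X P ->
    exists (d : nat) (F : 'I_m.+1 -> {mpoly k[n.+1]}),
      [/\ forall i, F i \is d.-homog,
          forall v, homog_coords P v -> eval_tuple F v != 0
        & forall Q v, X Q -> homog_coords Q v -> eval_tuple F v != 0 ->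
            homog_coords (phi Q) (eval_tuple F v)].

Definition isomorphic (k : fieldType) (n m : nat)
    (X : projset k n) (Y : projset k m) : Prop :=
  exists (phi : projspace k n -> projspace k m)
         (psi : projspace k m -> projspace k n),
    [/\ is_morphism X Y phi, is_morphism Y X psi,
        forall P, X P -> psi (phi P) = P
      & forall Q, Y Q -> phi (psi Q) = Q].

(* The nonsingular projective model in P^(g+2) of y^2 = f(x), for g >= 1, f   *)
(* separable of degree 2g+1 or 2g+2 and k algebraically closed of             *)
(* characteristic not 2: the closure of the image of the affine curve under   *)
(*     (x, y) |-> (1 : x : x^2 : ... : x^(g+1) : y).                          *)
(* With coordinates X_0, ..., X_(g+1), Y, it is cut out by the equations of   *)
(* the cone over the rational normal curve, X_i X_j = X_i' X_j' whenever      *)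
(* i + j = i' + j', and by the quadric obtained from y^2 = f(x) on writing    *)
(* x^i as X_a X_b with a = floor(i/2) and b = ceil(i/2).                      *)
Definition Xcoord (k : fieldType) (g i : nat) : {mpoly k[g.+3]} :=
  'X_(inord i).

Definition Ycoord (k : fieldType) (g : nat) : {mpoly k[g.+3]} :=
  'X_ord_max.

Inductive hyperelliptic_eqs (k : fieldType) (g : nat) (f : {poly k}) :
    {mpoly k[g.+3]} -> Prop :=
| Cone_eq (i j i' j' : nat) of
    (i <= g.+1)%N & (j <= g.+1)%N & (i' <= g.+1)%N & (j' <= g.+1)%N
    & (i + j = i' + j')%N :
    hyperelliptic_eqs f
      (Xcoord k g i * Xcoord k g j - Xcoord k g i' * Xcoord k g j')
| Quadric_eq :
    hyperelliptic_eqs f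
      (Ycoord k g ^+ 2
       - \sum_(i < (2 * g).+3) f`_i *: (Xcoord k g i./2 * Xcoord k g (uphalf i))).

Definition hyperelliptic (k : fieldType) (g : nat) (f : {poly k}) :
    projset k g.+2 :=
  zero_locus (hyperelliptic_eqs (g := g) f).
Arguments hyperelliptic {k} g f P.

Definition Hprime (k : fieldType) (lambda : k) : projset k 6 :=
  hyperelliptic 4 (('X^5 - 1) * ('X^5 - lambda%:P)).

(* The points of the model are the triples (s : t : y) of the weighted        *)
(* projective plane P(1, 1, g+1) on the homogenized equation y^2 = F(s, t).   *)
Definition weighted_coords (k : fieldType) (g : nat) (s t y : k) :
    'rV[k]_g.+3 :=
  \row_i (if (i <= g.+1)%N then s ^+ (g.+1 - i) * t ^+ i else y).

Lemma projspace_coords (k : fieldType) (n : nat) (P : projspace k n)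
    (v : 'rV[k]_n.+1) :
  homog_coords P v -> val P = <[v]>%VS.
Proof.
case=> v0 vP; apply/eqP; rewrite eq_sym eqEdim -memvE vP.
by rewrite (eqP (valP P)) dim_vline v0.
Qed.

Lemma hyperellipticP (k : fieldType) (g : nat) (f : {poly k})
    (P : projspace k g.+2) :
  hyperelliptic g f P <->
  exists s t y : k,
    [/\ (s != 0) || (t != 0),
        y ^+ 2 = \sum_(i < (2 * g).+3) f`_i * (s ^+ ((2 * g).+2 - i) * t ^+ i)
      & val P = <[weighted_coords g s t y]>%VS].
Proof.
have evX (v : 'rV[k]_g.+3) i : (Xcoord k g i).@[v 0] = v 0 (inord i).
  by rewrite mevalXU.
have evY (v : 'rV[k]_g.+3) : (Ycoord k g).@[v 0] = v 0 ord_max.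
  by rewrite mevalXU.
have evQ (v : 'rV[k]_g.+3) :
    (Ycoord k g ^+ 2 - \sum_(i < (2 * g).+3)
       f`_i *: (Xcoord k g i./2 * Xcoord k g (uphalf i))).@[v 0]
    = v 0 ord_max ^+ 2
      - \sum_(i < (2 * g).+3) f`_i * (v 0 (inord i./2) * v 0 (inord (uphalf i))).
  rewrite mevalB expr2 mevalM evY -expr2; congr (_ - _).
  rewrite raddf_sum /=; apply: eq_bigr => i _.
  by rewrite mevalZ mevalM !evX.
have wX (s t y : k) i : (i <= g.+1)%N ->
    weighted_coords g s t y 0 (inord i) = s ^+ (g.+1 - i) * t ^+ i.
  by move=> le_i; rewrite mxE inordK ?le_i // ltnS (leq_trans le_i).
have wY (s t y : k) : weighted_coords g s t y 0 ord_max = y.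
  by rewrite mxE /= ltnn.
have wXX (c s t y : k) i j : (i <= g.+1)%N -> (j <= g.+1)%N ->
    c * weighted_coords g s t y 0 (inord i) *
      (c * weighted_coords g s t y 0 (inord j))
    = c ^+ 2 * (s ^+ ((2 * g).+2 - (i + j)) * t ^+ (i + j)).
  move=> li lj; rewrite !wX // mulrACA [X in _ * X]mulrACA -!exprD -expr2.
  suff -> : (g.+1 - i + (g.+1 - j) = (2 * g).+2 - (i + j))%N by [].
  lia.
have halves (i : 'I_(2 * g).+3) :
    [/\ (i./2 <= g.+1)%N, (uphalf i <= g.+1)%N & (i./2 + uphalf i = i)%N].
  by have := ltn_ord i; split; lia.
have w_neq0 (s t y : k) : (s != 0) || (t != 0) -> weighted_coords g s t y != 0.
  move=> st; apply/eqP => w0; move: st.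
  have := wX s t y 0%N isT; have := wX s t y g.+1 (leqnn _).
  rewrite w0 !mxE subn0 subnn !expr0 mul1r mulr1 => /esym/eqP + /esym/eqP.
  by rewrite !expf_eq0 /= => /eqP -> /eqP ->; rewrite eqxx.
split=> [HP | [s [t [y [st Ey EP]]]] F v SF [v0 vP]]; last first.
  move: vP; rewrite EP => /vlineP[c Ev].
  have vE i : v 0 i = c * weighted_coords g s t y 0 i by rewrite Ev mxE.
  case: SF => [i j i' j' li lj li' lj' eij|].
    rewrite mevalB !mevalM !evX !vE.
    by rewrite !wXX // eij subrr.
  rewrite evQ vE wY exprMn Ey mulr_sumr.
  apply/eqP; rewrite subr_eq0; apply/eqP/eq_bigr => i _.
  have [l1 l2 ei] := halves i; by rewrite !vE wXX // ei mulrCA.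
have [v Pv] : exists v, homog_coords P v.
  have /eqP dP := valP P; exists (vpick (val P)); split; last exact: memv_pick.
  by rewrite vpick0 -dimv_eq0 dP.
have EP := projspace_coords Pv.
have cone i j i' j' : (i <= g.+1)%N -> (j <= g.+1)%N -> (i' <= g.+1)%N ->
    (j' <= g.+1)%N -> (i + j = i' + j')%N ->
    v 0 (inord i) * v 0 (inord j) = v 0 (inord i') * v 0 (inord j').
  move=> li lj li' lj' eij.
  have := HP _ _ (Cone_eq f li lj li' lj' eij) Pv.
  by rewrite mevalB !mevalM !evX => /eqP; rewrite subr_eq0 => /eqP.
have quad : v 0 ord_max ^+ 2 = \sum_(i < (2 * g).+3)
    f`_i * (v 0 (inord i./2) * v 0 (inord (uphalf i))).
  have := HP _ _ (Quadric_eq g f) Pv.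
  by rewrite evQ => /eqP; rewrite subr_eq0 => /eqP.
have [c [s [t [y [c0 st Ev]]]]] : exists c s t y : k,
    [/\ c != 0, (s != 0) || (t != 0) & v = c *: weighted_coords g s t y].
  have ord_cases (w : 'rV[k]_g.+3) :
      (forall i, (i <= g.+1)%N -> v 0 (inord i) = w 0 (inord i)) ->
      v 0 ord_max = w 0 ord_max -> v = w.
    move=> wi wm; apply/rowP => i; have [le_i|gt_i] := leqP i g.+1.
      by rewrite -[i]inord_val wi.
    suff -> : i = ord_max by [].
    by apply/val_inj => /=; have := ltn_ord i; lia.
  have [z|nz] := eqVneq (v 0 (inord 0)) 0.
    have vz i : (i <= g)%N -> v 0 (inord i) = 0.
      elim: i => // i IHi lt_i; apply/eqP; rewrite -sqrf_eq0 expr2.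
      rewrite (cone i.+1 i.+1 i i.+2); try lia.
      by rewrite IHi ?mul0r // ltnW.
    have nz : v 0 (inord g.+1) != 0.
      apply: contraNneq Pv.1 => z'; apply/eqP/ord_cases => [i le_i|].
        rewrite mxE; have [/vz //|gt_i] := leqP i g.
        by suff -> : i = g.+1 by []; lia.
      rewrite mxE; apply/eqP; rewrite -sqrf_eq0 quad big1 // => i _.
      have [l1 _ _] := halves i; have [/vz ->|gt_i] := leqP i./2 g.
        by rewrite mul0r mulr0.
      by have -> : i./2 = g.+1 by [lia]; rewrite z' mul0r mulr0.
    exists (v 0 (inord g.+1)), 0, 1, (v 0 ord_max / v 0 (inord g.+1)).
    rewrite oner_neq0 orbT; split=> //; apply: ord_cases => [i le_i|].
      rewrite mxE wX // expr1n mulr1.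
      have [le_ig|gt_i] := leqP i g.
        by rewrite vz // subSn // exprS mul0r mulr0.
      have -> : i = g.+1 by lia.
      by rewrite subnn mulr1.
    by rewrite mxE wY mulrC divfK.
  exists (v 0 (inord 0)), 1, (v 0 (inord 1) / v 0 (inord 0)),
    (v 0 ord_max / v 0 (inord 0)).
  rewrite oner_neq0; split=> //; apply: ord_cases => [i le_i|]; last first.
    by rewrite mxE wY mulrC divfK.
  rewrite mxE wX // expr1n mul1r; elim: i le_i => [|i IHi] le_i.
    by rewrite mulr1.
  apply: (mulfI nz); rewrite (cone 0 i.+1 1 i)%N //; last exact: ltnW.
  rewrite IHi; last exact: ltnW.
  by rewrite exprS; field.
exists s, t, y; split=> //.
  have vE i : v 0 i = c * weighted_coords g s t y 0 i by rewrite Ev mxE.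
  apply: (@mulfI _ (c ^+ 2)); first by rewrite expf_neq0.
  have := quad; rewrite vE wY exprMn => ->; rewrite mulr_sumr.
  apply: eq_bigr => i _.
  have [l1 l2 ei] := halves i; by rewrite !vE wXX // ei mulrCA.
rewrite EP Ev; apply/eqP; rewrite eqEsubv -!memvE.
rewrite memvZ ?memv_line //=; apply/vlineP; exists c^-1.
by rewrite scalerA mulVf ?scale1r.
Qed.

(* Main.v *)
Require Import Defs.
From mathcomp Require Import all_boot all_order all_algebra.
From mathcomp Require Import mpoly separable ring.
Set Implicit Arguments.
Unset Strict Implicit.
Unset Printing Implicit Defensive.
Import GRing.Theory.
Local Open Scope ring_scope.

(** An isomorphism between hyperelliptic curves of genus at least 2 induces an
    isomorphism between the projective lines that they cover doubly, and this
    Moebius transformation carries branch points to branch points. So the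
    theorem splits into the uniqueness of the double cover of the line, and the
    classification of the Moebius transformations that map the roots of
    (x^5 - 1)(x^5 - l1) to those of (x^5 - 1)(x^5 - l2).

    Uniqueness of the double cover, for curves y^2 = f1(x) and y'^2 = f2(x') of
    genus g >= 2 and an isomorphism phi with inverse psi. For general a the
    fibre x' = a consists of two points (a, b), (a, -b); let (x0, y0), (x1, y1)
    be their images under psi. The function r = 1 / (x' - a) o phi is regular
    elsewhere (regular_inverse_shift) and has at most simple poles at these two
    points (simple_pole), so that its product with the polynomial z having the
    roots x0, x1 is regular on the affine curve. Since r is also regular at
    infinity, where y has poles of order g + 1 > 2, this product is a polynomial
    A(x) of degree at most deg z (few_poles_polynomial). If x0 and x1 were
    distinct, then r would be regular at (x0, -y0) and (x1, -y1), hence A would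
    vanish at x0 and x1 and r would be constant, which is absurd
    (inverse_shift_nonconstant). So x0 = x1, one may take z = x - x0, and
    (x - x0) r = A(x) with A of degree at most 1 expresses x' o phi as a Moebius
    transformation of x (mobius_generic), at first off a finite set and then
    everywhere (isomorphism_mobius). Branch points are those alone in their
    fibre over the line (branch_points_correspond).

    Classification. With u = a0 + a1 x and v = b0 + b1 x the polynomial
    (v^5 - u^5)(v^5 - l2 u^5) has the ten roots of (x^5 - 1)(x^5 - l1), so it is
    a multiple of it and only involves x^0, x^5, x^10. If a0, a1, b0, b1 are all
    nonzero, the vanishing of the coefficients of x, ..., x^4 is contradictory
    (no_transverse_pullback). Otherwise the transformation is x |-> q x or
    x |-> q / x, and the three remaining coefficients give l1 = l2 or
    l1 l2 = 1 (mobius_two_pentagons).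

    Conversely, if l1 l2 = 1 then (x, y) |-> (1 / x, m y / x^5) with m^2 = l2 is
    an isomorphism (swap_isomorphic). *)

(** * Polynomial functions on the plane *)

Section Evaluation.
Variable k : fieldType.
Implicit Types (p q : {poly {poly k}}) (a b x y : k).

(** The coefficients are polynomials in x and the outer variable is y. *)
Definition eval2 p x y : k := p.[y%:P].[x].

Lemma eval2D p q x y : eval2 (p + q) x y = eval2 p x y + eval2 q x y.
Proof. by rewrite /eval2 !hornerD. Qed.

Lemma eval2N p x y : eval2 (- p) x y = - eval2 p x y.
Proof. by rewrite /eval2 !hornerN. Qed.

Lemma eval2M p q x y : eval2 (p * q) x y = eval2 p x y * eval2 q x y.
Proof. by rewrite /eval2 !hornerM. Qed.

Lemma eval2X p n x y : eval2 (p ^+ n) x y = eval2 p x y ^+ n.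
Proof. by rewrite /eval2 !horner_exp. Qed.

Lemma eval2C (c : {poly k}) x y : eval2 c%:P x y = c.[x].
Proof. by rewrite /eval2 hornerC. Qed.

Lemma eval2Y x y : eval2 'X x y = y.
Proof. by rewrite /eval2 hornerX hornerC. Qed.

Definition eval2E := (eval2D, eval2N, eval2M, eval2X, eval2C, eval2Y,
  hornerC, hornerX, hornerD, hornerN, hornerM).

Lemma eval2_comp_mpoly n (F : {mpoly k[n]}) (w : 'I_n -> {poly {poly k}}) :
  exists p, forall x y, F.@[fun i => eval2 (w i) x y] = eval2 p x y.
Proof.
elim/mpolyind: F => [|c m F _ _ [p Ep]].
  by exists 0 => x y; rewrite meval0 /eval2 !horner0.
exists ((c%:P)%:P * \prod_i w i ^+ m i + p) => x y.
rewrite mevalD mevalZ mevalX !eval2E Ep; congr (_ * _ + _).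
rewrite (big_morph (fun q => eval2 q x y) (fun q r => eval2M q r x y)
  (_ : _ = 1)); last by rewrite /eval2 !hornerC.
by apply: eq_bigr => i _; rewrite eval2X.
Qed.

(** Fractions whose denominator is a power of d form a ring, so a polynomial in
    two of them is again one. *)
Lemma eval2_comp_frac p (X Y d : {poly {poly k}}) :
  exists (q : {poly {poly k}}) (N : nat), forall x y, eval2 d x y != 0 ->
    eval2 p (eval2 X x y / eval2 d x y) (eval2 Y x y / eval2 d x y)
      * eval2 d x y ^+ N = eval2 q x y.
Proof.
have uni (c : {poly k}) : exists (q : {poly {poly k}}) (N : nat),
    forall x y, eval2 d x y != 0 ->
      c.[eval2 X x y / eval2 d x y] * eval2 d x y ^+ N = eval2 q x y.
  elim/poly_ind: c => [|c a [q [N E]]].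
    by exists 0, 0%N => x y _; rewrite horner0 mul0r /eval2 !horner0.
  exists (q * X + (a%:P)%:P * d ^+ N.+1), N.+1 => x y d0.
  by rewrite !eval2E -E // exprS; field.
elim/poly_ind: p => [|p c [q [N E]]].
  by exists 0, 0%N => x y _; rewrite /eval2 !horner0 mul0r.
have [r [M Er]] := uni c.
exists (q * Y * d ^+ M + r * d ^+ N.+1), (N.+1 + M)%N => x y d0.
by rewrite !eval2E -E // -Er // exprD exprS; field.
Qed.

End Evaluation.

(** * Regular functions on the plane curve y^2 = f(x) *)

Section PlaneCurve.
Variables (k : closedFieldType).
Hypothesis two_neq0 : 2 != 0 :> k.
Variable f : {poly k}.
Implicit Types (p q e n : {poly {poly k}}) (z c A B : {poly k}) (x y : k).

Lemma exists_sqrt (a : k) : exists y, y ^+ 2 = a.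
Proof.
have /closed_rootP[y] : size ('X^2 - a%:P) != 1%N by rewrite size_XnsubC.
by rewrite /root !hornerE subr_eq0 => /eqP; exists y.
Qed.

Lemma eval2_mod_curve p : exists A B, forall x y, y ^+ 2 = f.[x] ->
  eval2 p x y = A.[x] + B.[x] * y.
Proof.
elim/poly_ind: p => [|p c [A [B E]]].
  by exists 0, 0 => x y _; rewrite /eval2 !horner0 mul0r addr0.
exists (B * f + c), A => x y xy.
by rewrite !eval2E E // -xy; ring.
Qed.

(** Modulo y^2 = f the polynomial is A + B y. Above almost every x there are two
    opposite values of y, so A and B f have infinitely many roots. *)
Lemma curve_identity p z : z != 0 -> f != 0 ->
    (forall x y, y ^+ 2 = f.[x] -> z.[x] != 0 -> eval2 p x y = 0) ->
  forall x y, y ^+ 2 = f.[x] -> eval2 p x y = 0.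
Proof.
move=> z0 f0 p0; have [A [B E]] := eval2_mod_curve p.
have AB x : z.[x] != 0 -> A.[x] = 0 /\ B.[x] * f.[x] = 0.
  move=> zx; have [y xy] := exists_sqrt f.[x].
  have := p0 x y xy zx; have := p0 x (- y); rewrite sqrrN => /(_ xy zx).
  rewrite !E ?sqrrN // => e1 e2; split.
    apply: (mulfI two_neq0); rewrite mulr0 -[RHS]addr0.
    by rewrite -{1}e1 -e2; ring.
  apply: (mulfI two_neq0); rewrite mulr0 -xy.
  transitivity (y * ((A.[x] + B.[x] * y) - (A.[x] + B.[x] * - y))); first by ring.
  by rewrite e1 e2 subrr mulr0.
have nul c : (forall x, z.[x] != 0 -> c.[x] = 0) -> c = 0.
  move=> c0; apply/eqP; apply: contraT => cn0.
  have /closed_nonrootP[x] : z * c != 0 by rewrite mulf_neq0.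
  rewrite /root hornerM mulf_eq0 negb_or => /andP[/c0 ->].
  by rewrite eqxx.
move=> x y xy.
have A0 : A = 0 by apply: nul => u /AB[].
have /eqP : B * f = 0 by apply: nul => u /AB[_]; rewrite hornerM.
rewrite mulf_eq0 (negPf f0) orbF => /eqP B0.
by rewrite E // A0 B0 !horner0 mul0r addr0.
Qed.

(** Regularity at (x0, y0) of a rational function r. As r is represented by a
    total function, its values at its own poles are meaningless; the auxiliary
    polynomial z serves to discard them. *)
Definition regular_off z x0 y0 (r : k -> k -> k) : Prop :=
  exists n e, eval2 e x0 y0 != 0 /\
    forall x y, y ^+ 2 = f.[x] -> z.[x] != 0 -> eval2 e x y != 0 ->
      r x y * eval2 e x y = eval2 n x y.

Lemma regular_off_mul z z' c x0 y0 r :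
  (forall x, z'.[x] != 0 -> z.[x] != 0) ->
  regular_off z x0 y0 r -> regular_off z' x0 y0 (fun x y => c.[x] * r x y).
Proof.
move=> zz' [n [e [e0 E]]]; exists (c%:P * n), e; split=> // x y xy zx ex.
by rewrite !eval2E -E ?zz' // mulrA.
Qed.

(** If r is regular above x0, then A + B y = c r vanishes at the points (x0, y0)
    and (x0, -y0), whence the result if y0 != 0. If y0 = 0 this only gives
    A(x0) = 0. But then y is a uniformizer because x0 is a simple root of f:
    dividing c r y = A y + B f by x - x0 and evaluating at the point gives
    B(x0) f'(x0) = 0. *)
Lemma regular_numerator_root z c A B r x0 : z != 0 -> f != 0 ->
    (f.[x0] = 0 -> f^`().[x0] != 0) ->
    (forall y0, y0 ^+ 2 = f.[x0] -> regular_off z x0 y0 r) ->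
    c.[x0] = 0 ->
    (forall x y, y ^+ 2 = f.[x] -> z.[x] != 0 ->
       c.[x] * r x y = A.[x] + B.[x] * y) ->
  A.[x0] = 0 /\ B.[x0] = 0.
Proof.
move=> z0 f0 sep reg c0 E.
have P0 y0 : y0 ^+ 2 = f.[x0] -> A.[x0] + B.[x0] * y0 = 0.
  move=> xy0; have [n [e [e0 En]]] := reg _ xy0.
  suff : eval2 (e * (c%:P * n - e * (A%:P + B%:P * 'X))) x0 y0 = 0.
    move/eqP; rewrite !eval2E c0 mul0r sub0r.
    by rewrite mulf_eq0 (negPf e0) /= oppr_eq0 mulf_eq0 (negPf e0) => /eqP.
  apply: (curve_identity z0 f0) xy0 => x y xy zx; rewrite !eval2E.
  have [->|ex] := eqVneq (eval2 e x y) 0; first by rewrite mul0r.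
  by rewrite -E // -En //; ring.
have [y0 xy0] := exists_sqrt f.[x0].
have [y00|y0n] := eqVneq y0 0; last first.
  have := P0 y0 xy0; have := P0 (- y0); rewrite sqrrN => /(_ xy0) e1 e2.
  have A0 : A.[x0] = 0.
    apply: (mulfI two_neq0); rewrite mulr0 -[RHS]addr0 -{1}e1 -e2; ring.
  split=> //; move: e2; rewrite A0 add0r => /eqP.
  by rewrite mulf_eq0 (negPf y0n) orbF => /eqP.
have A0 : A.[x0] = 0 by have := P0 _ xy0; rewrite y00 mulr0 addr0.
split=> //.
have fx0 : f.[x0] = 0 by rewrite -xy0 y00 expr0n.
have root_fac g : g.[x0] = 0 -> exists h, g = h * ('X - x0%:P).
  by move=> g0; have /factor_theorem : root g x0 by apply/eqP.
have [c' Ec] := root_fac _ c0; have [A' EA] := root_fac _ A0.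
have [f' Ef] := root_fac _ fx0.
have f'0 : f'.[x0] != 0.
  have := sep fx0; rewrite Ef derivM hornerD !hornerM derivXsubC.
  by rewrite !hornerE subrr mulr0 add0r.
have [n [e [e0 En]]] := reg _ xy0.
have zX0 : z * ('X - x0%:P) != 0 by rewrite mulf_neq0 ?polyXsubC_eq0.
suff : eval2 (e * (c'%:P * n * 'X - e * (A'%:P * 'X + (B * f')%:P))) x0 y0 = 0.
  move/eqP; rewrite !eval2E y00 !mulr0 sub0r add0r; rewrite y00 in e0.
  by rewrite mulf_eq0 oppr_eq0 !mulf_eq0 (negPf e0) (negPf f'0) orbF => /eqP.
apply: (curve_identity zX0 f0) xy0 => x y xy.
rewrite hornerM hornerXsubC mulf_eq0 negb_or => /andP[zx xx0].
rewrite !eval2E.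
have [->|ex] := eqVneq (eval2 e x y) 0; first by rewrite mul0r.
apply: (mulfI xx0); rewrite mulr0.
have -> : (x - x0) * (eval2 e x y * (c'.[x] * eval2 n x y * y -
    eval2 e x y * (A'.[x] * y + B.[x] * f'.[x]))) =
  eval2 e x y * (c'.[x] * (x - x0) * eval2 n x y * y -
    eval2 e x y * (A'.[x] * (x - x0) * y + B.[x] * (f'.[x] * (x - x0)))) by ring.
have Ex : c'.[x] * (x - x0) * r x y = A'.[x] * (x - x0) + B.[x] * y.
  by have := E x y xy zx; rewrite Ec EA !hornerM !hornerXsubC.
have <- : y ^+ 2 = f'.[x] * (x - x0) by rewrite xy Ef hornerM hornerXsubC.
rewrite -En // [X in X - _](_ : _ =
  c'.[x] * (x - x0) * r x y * (eval2 e x y * y)); last by ring.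
by rewrite Ex; ring.
Qed.

(** The roots of c are removed from the fraction (A + B y) / c one by one. *)
Lemma regular_numerator_dvdp z c A B r : z != 0 -> f != 0 -> c != 0 ->
    (forall x0, c.[x0] = 0 -> (f.[x0] = 0 -> f^`().[x0] != 0) /\
       forall y0, y0 ^+ 2 = f.[x0] -> regular_off z x0 y0 r) ->
    (forall x y, y ^+ 2 = f.[x] -> z.[x] != 0 ->
       c.[x] * r x y = A.[x] + B.[x] * y) ->
  exists A' B', A = A' * c /\ B = B' * c.
Proof.
move=> z0 f0; have [N] := ubnP (size c).
elim: N => // N IH in z z0 c A B *; rewrite ltnS => leN c0 reg E.
have [/eqP/size_poly1P[a a0 ->]|sc] := eqVneq (size c) 1%N.
  by exists (A * a^-1%:P), (B * a^-1%:P);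
    rewrite -!mulrA -polyCM mulVf // !mulr1.
have /closed_rootP[x0 rx0] : size c != 1%N by [].
have /factor_theorem[c' Ec] := rx0.
have [sx rg] := reg _ (eqP rx0).
have [A0 B0] := regular_numerator_root z0 f0 sx rg (eqP rx0) E.
have /factor_theorem[A1 EA] : root A x0 by apply/eqP.
have /factor_theorem[B1 EB] : root B x0 by apply/eqP.
have c'0 : c' != 0 by apply: contraNneq c0 => c'0; rewrite Ec c'0 mul0r.
have zX0 : z * ('X - x0%:P) != 0 by rewrite mulf_neq0 ?polyXsubC_eq0.
have [| | | |A' [B' [EA1 EB1]]] := IH _ zX0 c' A1 B1.
- apply: leq_trans leN; by rewrite Ec size_Mmonic ?monicXsubC // size_XsubC addn2.
- by [].
- move=> x1 c'x1; have [|s1 r1] := reg x1; first by rewrite Ec hornerM c'x1 mul0r.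
  split=> // y1 /r1[n [e [e0 En]]]; exists n, e; split=> // x y xy.
  by rewrite hornerM mulf_eq0 negb_or => /andP[zx _]; apply: En.
- move=> x y xy; rewrite hornerM hornerXsubC mulf_eq0 negb_or => /andP[zx xx0].
  apply: (mulIf xx0); have := E x y xy zx; rewrite Ec EA EB !hornerM hornerXsubC.
  by rewrite mulrAC => ->; ring.
by exists A', B'; rewrite EA EB Ec EA1 EB1 !mulrA.
Qed.

End PlaneCurve.

(** * Functions with few poles *)

(** The curve y^2 = f(x) is v^2 = reverse_poly (2 * g).+2 f at infinity, in the
    coordinates u = 1 / x and v = y / x^(g+1). *)
Definition reverse_poly (k : fieldType) n (c : {poly k}) : {poly k} :=
  \poly_(i < n.+1) c`_(n - i).

Lemma horner_reverse (k : fieldType) n (c : {poly k}) u :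
  (size c <= n.+1)%N -> u != 0 ->
  (reverse_poly n c).[u] = u ^+ n * c.[u^-1].
Proof.
move=> sc u0; rewrite horner_poly (horner_coef_wide _ sc) mulr_sumr.
rewrite (reindex_inj rev_ord_inj); apply: eq_bigr => i _ /=.
have le_in : (i <= n)%N by rewrite -ltnS.
rewrite subSS subKn // mulrCA; congr (_ * _).
by rewrite -[X in _ = u ^+ X * _](subnK le_in) exprD exprVn mulfK // expf_neq0.
Qed.

Lemma reverse_poly_neq0 (k : closedFieldType) n (c : {poly k}) :
  (size c <= n.+1)%N -> c != 0 -> reverse_poly n c != 0.
Proof.
move=> sc c0; have /closed_nonrootP[x] : 'X * c != 0.
  by rewrite mulf_neq0 ?polyX_eq0.
rewrite /root hornerM hornerX mulf_eq0 negb_or => /andP[x0 cx].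
apply: contraNneq cx => E; have := horner_reverse sc (invr_neq0 x0).
rewrite E horner0 invrK => /esym/eqP.
by rewrite mulf_eq0 expf_eq0 invr_eq0 (negPf x0) andbF.
Qed.

Lemma coef_reverse (k : fieldType) n (c : {poly k}) i :
  (i <= n)%N -> (reverse_poly n c)`_(n - i) = c`_i.
Proof. by move=> le_in; rewrite coef_poly ltnS leq_subr subKn. Qed.

Section Poles.
Variable k : closedFieldType.
Hypothesis two_neq0 : 2 != 0 :> k.
Variables (g : nat) (f : {poly k}).
Hypotheses (f_neq0 : f != 0) (size_f : (size f <= (2 * g).+3)%N)
  (lead_f : f`_(2 * g).+2 != 0)
  (sep_f : forall x, f.[x] = 0 -> f^`().[x] != 0).

(** Regularity at one branch point already provides a denominator: the norm of
    the local one, a polynomial in x. Its roots are then removed. *)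
Lemma regular_affine_polynomial z r : z != 0 ->
    (forall x0 y0, y0 ^+ 2 = f.[x0] -> regular_off f z x0 y0 r) ->
  exists (A B z' : {poly k}), [/\ z' != 0, forall x, z'.[x] != 0 -> z.[x] != 0 &
    forall x y, y ^+ 2 = f.[x] -> z'.[x] != 0 -> r x y = A.[x] + B.[x] * y].
Proof.
move=> z0 reg.
have /closed_rootP[x1 /eqP fx1] : size f != 1%N.
  have : ((2 * g).+2 < size f)%N by rewrite ltnNge; apply: contra lead_f => /leq_sizeP->.
  by case: (size f) => [|[]].
have [|n [e [e0 En]]] := reg x1 0; first by rewrite fx1 expr0n.
have [e1 [e2 Ee]] := eval2_mod_curve f e; have [n1 [n2 Enn]] := eval2_mod_curve f n.
pose N := e1 ^+ 2 - e2 ^+ 2 * f.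
(* Non-vanishing at a branch point, where e = e1, makes the norm of e nonzero. *)
have N0 : N != 0.
  apply: contraNneq e0 => N0; rewrite Ee ?fx1 ?expr0n //= mulr0 addr0.
  have : N.[x1] = 0 by rewrite N0 horner0.
  by rewrite /N hornerD hornerN !hornerM fx1 mulr0 subr0 => /eqP; rewrite mulf_eq0 orbb.
have EN x y : y ^+ 2 = f.[x] -> N.[x] = eval2 e x y * (e1.[x] - e2.[x] * y).
  by move=> xy; rewrite Ee // /N !hornerE -xy; ring.
have zN : z * N != 0 by rewrite mulf_neq0.
have [||A [B [EA EB]]] := @regular_numerator_dvdp k two_neq0 f (z * N) N
    (e1 * n1 - e2 * n2 * f) (e1 * n2 - e2 * n1) r zN f_neq0 N0.
- move=> x0 _; split=> [|y0 /reg]; first exact: sep_f.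
  move=> [n' [e' [e'0 E']]]; exists n', e'; split=> // x y xy.
  by rewrite hornerM mulf_eq0 negb_or => /andP[zx _]; apply: E'.
- move=> x y xy; rewrite hornerM mulf_eq0 negb_or => /andP[zx Nx].
  rewrite (EN _ _ xy); have ex : eval2 e x y != 0.
    by apply: contraNneq Nx => ex; rewrite (EN _ _ xy) ex mul0r.
  rewrite mulrC mulrA (En _ _ xy zx ex) (Enn _ _ xy).
  by rewrite !hornerE -xy; ring.
exists A, B, (z * N); split=> // [x|x y xy].
  by rewrite hornerM mulf_eq0 negb_or => /andP[].
rewrite hornerM mulf_eq0 negb_or => /andP[zx Nx].
apply: (mulfI Nx); rewrite {1}(EN _ _ xy); have ex : eval2 e x y != 0.
  by apply: contraNneq Nx => ex; rewrite (EN _ _ xy) ex mul0r.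
rewrite mulrC mulrA (En _ _ xy zx ex) (Enn _ _ xy).
transitivity ((A * N).[x] + (B * N).[x] * y); last by rewrite !hornerM; ring.
by rewrite -EA -EB !hornerE -xy; ring.
Qed.

(** The product z r is A + B y on the affine curve. At infinity it has poles of
    order at most size L <= g, whereas y has poles of order g + 1 there; so B = 0
    and A has degree at most size L. To see this, z r is multiplied by a large
    power of u = 1 / x, which turns A and B into polynomials in u that are
    divisible by a power of u by regularity at u = 0. *)
Lemma few_poles_polynomial (L : seq k) (r rinf : k -> k -> k) :
    let z := \prod_(l <- L) ('X - l%:P) in
    let frev := reverse_poly (2 * g).+2 f in
    (size L <= g)%N ->
    (forall x0 y0, y0 ^+ 2 = f.[x0] ->
       regular_off f z x0 y0 (fun x y => z.[x] * r x y)) ->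
    (forall v0, v0 ^+ 2 = frev.[0] -> regular_off frev 1 0 v0 rinf) ->
    (forall u v, u != 0 -> v ^+ 2 = frev.[u] ->
       rinf u v = r u^-1 (v / u ^+ g.+1)) ->
  exists (A z' : {poly k}), [/\ z' != 0, (size A <= (size L).+1)%N,
    forall x, z'.[x] != 0 -> z.[x] != 0 &
    forall x y, y ^+ 2 = f.[x] -> z'.[x] != 0 -> z.[x] * r x y = A.[x]].
Proof.
move=> z frev sL reg0 reginf Erinf.
have z0 : z != 0 by rewrite monic_neq0 ?monic_prod_XsubC.
have [A [B [z' [z'0 z'z E]]]] := regular_affine_polynomial z0 reg0.
pose m := size L; pose M' := (size A + size B + m)%N.
pose K := (size A + size B + g.+1)%N; pose M := (M' + g.+1)%N.
have MK : M = (K + m)%N by rewrite /M /K addnAC.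
have sz : (size z <= m.+1)%N by rewrite size_prod_XsubC.
pose w := reverse_poly m z; pose zz := reverse_poly (size z') z'.
have frev0 : frev != 0 by apply: reverse_poly_neq0.
have frev00 : frev.[0] != 0 by rewrite horner_coef0 -(subnn (2 * g).+2) coef_reverse.
have zz0 : 'X * zz != 0.
  by rewrite mulf_neq0 ?polyX_eq0 // reverse_poly_neq0.
have XK0 : 'X^K != 0 :> {poly k} by rewrite monic_neq0 ?monicXn.
have sA : (size A <= M.+1)%N by rewrite /M /M' -!addnA leqW ?leq_addr.
have sB : (size B <= M'.+1)%N by rewrite /M' -addnAC addnC leqW ?leq_addr.
have [||A' [B' [EA EB]]] := @regular_numerator_dvdp k two_neq0 frev ('X * zz)
    'X^K (reverse_poly M A) (reverse_poly M' B)
    (fun u v => w.[u] * rinf u v) zz0 frev0 XK0.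
- move=> u; rewrite hornerXn => /eqP; rewrite expf_eq0 => /andP[_ /eqP ->].
  split=> [/eqP|v0 uv]; first by rewrite (negPf frev00).
  by apply: (regular_off_mul (z := 1)) (reginf _ uv) => x _; rewrite hornerE oner_neq0.
- move=> u v uv; rewrite hornerM hornerX mulf_eq0 negb_or => /andP[u0].
  rewrite /zz horner_reverse // mulf_eq0 negb_or => /andP[_ zu].
  have xy : (v / u ^+ g.+1) ^+ 2 = f.[u^-1].
    rewrite exprMn exprVn uv horner_reverse // -exprM.
    rewrite [(g.+1 * 2)%N]mulnC mulnS add2n.
    by rewrite mulrAC divff ?mul1r // expf_neq0.
  rewrite hornerXn Erinf // /w !horner_reverse //.
  have ug : u ^+ g.+1 != 0 by rewrite expf_neq0.
  transitivity (u ^+ M * (z.[u^-1] * r u^-1 (v / u ^+ g.+1))).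
    by rewrite MK exprD !mulrA.
  by rewrite E // [u ^+ M]exprD mulrDr; congr (_ + _); field.
have sAm : (size A <= m.+1)%N.
  apply/leq_sizeP => j ltj; have [lejM|ltM] := leqP j M; last first.
    by rewrite nth_default // (leq_trans sA).
  rewrite -(coef_reverse A lejM) EA coefMXn.
  by rewrite ltn_subLR ?addn_gt0 ?orbT // MK addnC ltn_add2r ltj.
have B0 : B = 0.
  apply/polyP => j; rewrite coef0; have [lejM|ltM] := leqP j M'; last first.
    by rewrite nth_default // (leq_trans sB).
  rewrite -(coef_reverse B lejM) EB coefMXn.
  by rewrite (leq_ltn_trans (leq_subr _ _)) // /M' /K ltn_add2l.
exists A, z'; split=> // x y xy zx.
by rewrite E // B0 horner0 mul0r addr0.
Qed.

End Poles.

(** * Points of hyperelliptic curves *)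

Section ProjectivePoints.
Variables (k : fieldType) (n : nat).
Implicit Types (P : projspace k n) (v w : 'rV[k]_n.+1).

Lemma dim_line_const1 : \dim <[const_mx 1 : 'rV[k]_n.+1]>%VS == 1%N.
Proof.
rewrite dim_vline; case: (eqVneq (const_mx 1) 0) => // /matrixP/(_ 0 0).
by rewrite !mxE => /eqP; rewrite oner_eq0.
Qed.

(** The point with homogeneous coordinates v; the line through (1 : ... : 1) is a
    default value for v = 0. *)
Definition point v : projspace k n :=
  insubd (exist (fun L => \dim L == 1%N) _ dim_line_const1) <[v]>%VS.

Lemma val_point v : v != 0 -> val (point v) = <[v]>%VS.
Proof. by move=> v0; rewrite insubdK // unfold_in /= dim_vline v0. Qed.

Lemma homog_coords_line P w : val P = <[w]>%VS -> w != 0 -> homog_coords P w.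
Proof. by move=> EP w0; split=> //; rewrite EP memv_line. Qed.

Lemma homog_coords_scale P v w : homog_coords P v -> val P = <[w]>%VS ->
  exists2 c, c != 0 & v = c *: w.
Proof.
case=> v0 vP EP; move: vP; rewrite EP => /vlineP[c Ev]; exists c => //.
by apply: contraNneq v0 => c0; rewrite Ev c0 scale0r.
Qed.

Lemma line_scale c v : c != 0 -> <[c *: v]>%VS = <[v]>%VS.
Proof.
move=> c0; apply/eqP; rewrite eqEsubv -!memvE memvZ ?memv_line //=.
by apply/vlineP; exists c^-1; rewrite scalerA mulVf ?scale1r.
Qed.

Lemma line_eq v w : w != 0 -> <[v]>%VS = <[w]>%VS -> exists2 c, c != 0 & w = c *: v.
Proof.
move=> w0 E; have : w \in <[v]>%VS by rewrite E memv_line.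
case/vlineP=> c Ew; exists c => //.
by apply: contraNneq w0 => c0; rewrite Ew c0 scale0r.
Qed.

Lemma vpick_homog_coords P : homog_coords P (vpick (val P)).
Proof.
split; last exact: memv_pick.
by rewrite vpick0 -dimv_eq0 (eqP (valP P)).
Qed.

End ProjectivePoints.

Section WeightedCoordinates.
Variables (k : fieldType) (g : nat).
Implicit Types (f : {poly k}) (s t x y u c a : k).

Local Notation E := (weighted_coords g).

Definition binary_form f s t : k :=
  \sum_(i < (2 * g).+3) f`_i * (s ^+ ((2 * g).+2 - i) * t ^+ i).

Lemma binary_form_affine f x : (size f <= (2 * g).+3)%N ->
  binary_form f 1 x = f.[x].
Proof.
move=> sf; rewrite (horner_coef_wide _ sf); apply: eq_bigr => i _.
by rewrite expr1n mul1r.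
Qed.

Lemma binary_form_infinity f u :
  binary_form f u 1 = (reverse_poly (2 * g).+2 f).[u].
Proof.
rewrite horner_poly [RHS](reindex_inj rev_ord_inj) /=; apply: eq_bigr => i _.
by rewrite expr1n mulr1 subSS subKn // -ltnS.
Qed.

Lemma binary_form_scale f c s t :
  binary_form f (c * s) (c * t) = c ^+ (2 * g).+2 * binary_form f s t.
Proof.
rewrite mulr_sumr; apply: eq_bigr => i _; rewrite !exprMn.
have le_i : (i <= (2 * g).+2)%N by rewrite -ltnS.
by rewrite -[X in c ^+ X * _](subnK le_i) exprD; ring.
Qed.

Lemma weightedX s t y i : (i <= g.+1)%N ->
  E s t y 0 (inord i) = s ^+ (g.+1 - i) * t ^+ i.
Proof. by move=> le_i; rewrite mxE inordK ?le_i // ltnS (leq_trans le_i). Qed.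

Lemma weightedY s t y : E s t y 0 ord_max = y.
Proof. by rewrite mxE /= ltnn. Qed.

Lemma weighted0 s t y : E s t y 0 (inord 0) = s ^+ g.+1.
Proof. by rewrite weightedX // subn0 mulr1. Qed.

Lemma weighted1 s t y : E s t y 0 (inord 1) = s ^+ g * t.
Proof. by rewrite weightedX // subn1. Qed.

Lemma weightedg s t y : E s t y 0 (inord g) = s * t ^+ g.
Proof. by rewrite weightedX // subSnn. Qed.

Lemma weightedg1 s t y : E s t y 0 (inord g.+1) = t ^+ g.+1.
Proof. by rewrite weightedX // subnn mul1r. Qed.

Lemma weighted_neq0 s t y : (s != 0) || (t != 0) -> E s t y != 0.
Proof.
move=> st; apply/eqP => w0; move: st.
have := weightedg1 s t y; have := weighted0 s t y.
rewrite w0 !mxE => /esym/eqP + /esym/eqP.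
by rewrite !expf_eq0 /= => /eqP -> /eqP ->; rewrite eqxx.
Qed.

Lemma weighted_scale c s t y :
  E (c * s) (c * t) (c ^+ g.+1 * y) = c ^+ g.+1 *: E s t y.
Proof.
apply/rowP => i; rewrite !mxE; case: leqP => // le_i.
by rewrite !exprMn -[in X in _ = X * _](subnK le_i) exprD; ring.
Qed.

Lemma weighted_affine s t y : s != 0 ->
  <[E s t y]>%VS = <[E 1 (t / s) (y / s ^+ g.+1)]>%VS.
Proof.
move=> s0; have sg : s ^+ g.+1 != 0 by rewrite expf_neq0.
rewrite -[RHS](line_scale _ sg) -weighted_scale mulr1.
by congr <[E _ _ _]>%VS; rewrite mulrC divfK.
Qed.

Lemma weighted_inj s t y s' t' y' :
    (s != 0) || (t != 0) -> (s' != 0) || (t' != 0) ->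
    <[E s t y]>%VS = <[E s' t' y']>%VS ->
  exists c, [/\ c != 0, s' = c * s, t' = c * t & y' = c ^+ g.+1 * y].
Proof.
move=> st st' /(line_eq (weighted_neq0 y' st'))[d d0 Ed].
have Ei i : E s' t' y' 0 i = d * E s t y 0 i by rewrite Ed mxE.
have := Ei (inord 0); have := Ei (inord 1); have := Ei (inord g.+1).
have := Ei ord_max; rewrite !weightedY !weighted0 !weighted1 !weightedg1.
move=> Ey Et Es1 Es.
have [s0|s0] := eqVneq s 0.
  have t0 : t != 0 by move: st; rewrite s0 eqxx.
  have s'0 : s' = 0.
    by apply/eqP; move: Es => /eqP; rewrite s0 [0 ^+ _]exprS mul0r mulr0 expf_eq0.
  have t'0 : t' != 0 by move: st'; rewrite s'0 eqxx.
  have Ed' : d = (t' / t) ^+ g.+1 by rewrite exprMn exprVn Et mulfK // expf_neq0.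
  exists (t' / t); rewrite mulf_neq0 ?invr_eq0 // s0 s'0 mulr0 divfK //.
  by rewrite Ey -Ed'.
have s'0 : s' != 0.
  have : s' ^+ g.+1 != 0 by rewrite Es mulf_neq0 ?expf_neq0.
  by rewrite expf_eq0.
have Ed' : d = (s' / s) ^+ g.+1 by rewrite exprMn exprVn Es mulfK // expf_neq0.
exists (s' / s); rewrite mulf_neq0 ?invr_eq0 // divfK //; split=> //.
  have sg : s' ^+ g != 0 by rewrite expf_neq0.
  have sg' : s ^+ g != 0 by rewrite expf_neq0.
  by apply: (mulfI sg); rewrite Es1 Ed' exprMn exprVn !exprS; field; rewrite s0.
by rewrite Ey -Ed'.
Qed.

Lemma weighted_affine_inj x y x' y' :
  <[E 1 x y]>%VS = <[E 1 x' y']>%VS -> x = x' /\ y = y'.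
Proof.
case/weighted_inj; rewrite ?oner_neq0 // => c [_]; rewrite mulr1 => <-.
by rewrite expr1n !mul1r.
Qed.

(** The rational function s / (t - a s), that is 1 / (x - a), in terms of the two
    coordinates s^(g+1) and s^g t. Both vanish at infinity if g > 0, and then the
    convention 0 / 0 = 0 gives the true value. *)
Definition inverse_shift a (P : projspace k g.+2) : k :=
  let v := vpick (val P) in v 0 (inord 0) / (v 0 (inord 1) - a * v 0 (inord 0)).

Lemma inverse_shiftE a P s t y : val P = <[E s t y]>%VS ->
  inverse_shift a P = s / (t - a * s).
Proof.
move=> EP; have [c c0 Ev] := homog_coords_scale (vpick_homog_coords P) EP.
have vE i : vpick (val P) 0 i = c * E s t y 0 i by rewrite Ev mxE.
rewrite /inverse_shift !vE weighted0 weighted1.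
have [->|s0] := eqVneq s 0; first by rewrite exprS !(mul0r, mulr0).
have cs : c * s ^+ g != 0 by rewrite mulf_neq0 ?expf_neq0.
rewrite (_ : _ - _ = (c * s ^+ g) * (t - a * s)); last by rewrite exprS; ring.
by rewrite exprSr mulrA -mulf_div divff // mul1r.
Qed.

End WeightedCoordinates.

(** * Morphisms in affine charts *)

Section Charts.
Variables (k : fieldType) (g : nat).
Implicit Types (f : {poly k}) (s t x y u c a : k) (b : bool).

(** The chart true is the affine plane curve s = 1, the chart false is the one
    at infinity, t = 1. *)
Definition chart_s b x : k := if b then 1 else x.
Definition chart_t b x : k := if b then x else 1.
Definition chart b x y := weighted_coords g (chart_s b x) (chart_t b x) y.
Definition chart_poly f b := if b then f else reverse_poly (2 * g).+2 f.

Lemma chart_st b x : (chart_s b x != 0) || (chart_t b x != 0).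
Proof. by case: b; rewrite oner_neq0 ?orbT. Qed.

Lemma chart_neq0 b x y : chart b x y != 0.
Proof. exact/weighted_neq0/chart_st. Qed.

Lemma chart_flip u v : u != 0 ->
  point (chart false u v) = point (chart true u^-1 (v / u ^+ g.+1)).
Proof.
move=> u0; apply/val_inj; rewrite !val_point ?chart_neq0 //.
by rewrite /chart /= (weighted_affine _ _ _ u0) mul1r.
Qed.

Lemma binary_form_chart f b x : (size f <= (2 * g).+3)%N ->
  binary_form g f (chart_s b x) (chart_t b x) = (chart_poly f b).[x].
Proof.
by case: b => sf; rewrite ?binary_form_affine ?binary_form_infinity.
Qed.

Lemma meval_chart b (F : {mpoly k[g.+3]}) :
  exists p, forall x y, F.@[chart b x y 0] = eval2 p x y.
Proof.
pose w (i : 'I_g.+3) : {poly {poly k}} := if (i <= g.+1)%N then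
  ((if b then 'X^i else 'X^(g.+1 - i)) : {poly k})%:P else 'X.
have [p Ep] := eval2_comp_mpoly F w.
exists p => x y; rewrite -Ep; apply: meval_eq => i; rewrite mxE /w.
case: leqP => _; last by rewrite eval2Y.
by rewrite eval2C; case: b {w Ep}; rewrite /= hornerXn expr1n ?mul1r ?mulr1.
Qed.

End Charts.

Lemma hyperelliptic_point (k : fieldType) g (f : {poly k}) s t y :
  (s != 0) || (t != 0) -> y ^+ 2 = binary_form g f s t ->
  hyperelliptic g f (point (weighted_coords g s t y)).
Proof.
move=> st Ey; apply/hyperellipticP; exists s, t, y.
by split=> //; rewrite val_point ?weighted_neq0.
Qed.

Section Morphisms.
Variables (k : closedFieldType) (g : nat) (f1 f2 : {poly k}).
Hypotheses (size_f1 : (size f1 <= (2 * g).+3)%N).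
Variable phi : projspace k g.+2 -> projspace k g.+2.
Hypothesis phi_mor : is_morphism (hyperelliptic g f1) (hyperelliptic g f2) phi.
Implicit Types (s t x y u c a : k) (b : bool).

Local Notation E := (weighted_coords g).

Lemma hyperelliptic_chart b x y : y ^+ 2 = (chart_poly g f1 b).[x] ->
  hyperelliptic g f1 (point (chart g b x y)).
Proof.
move=> xy; apply: hyperelliptic_point; first exact: chart_st.
by rewrite binary_form_chart.
Qed.

(** In a chart, the forms that define a morphism near a point become polynomials
    in the two plane coordinates. *)
Lemma local_polynomials b x0 y0 : y0 ^+ 2 = (chart_poly g f1 b).[x0] ->
  exists q : 'I_g.+3 -> {poly {poly k}},
    \row_i eval2 (q i) x0 y0 != 0 /\
    forall x y, y ^+ 2 = (chart_poly g f1 b).[x] -> \row_i eval2 (q i) x y != 0 ->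
      exists c s t y', [/\ c != 0, (s != 0) || (t != 0), y' ^+ 2 = binary_form g f2 s t,
        val (phi (point (chart g b x y))) = <[E s t y']>%VS
      & forall i, eval2 (q i) x y = c * E s t y' 0 i].
Proof.
move=> xy0; have [inY /(_ _ (hyperelliptic_chart xy0))[d [F [_ F0 EF]]]] := phi_mor.
have hc x y : homog_coords (point (chart g b x y)) (chart g b x y).
  by apply: homog_coords_line; rewrite ?val_point ?chart_neq0.
have [q Eq] := fin_all_exists (fun i => meval_chart b (F i)).
have eF x y : eval_tuple F (chart g b x y) = \row_i eval2 (q i) x y.
  by apply/rowP => i; rewrite !mxE Eq.
exists q; split=> [|x y xy]; first by rewrite -eF F0.
rewrite -eF => F1; have X1 := hyperelliptic_chart xy.
have [s [t [y' [st Ey' EP]]]] := (hyperellipticP _ _).1 (inY _ X1).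
have [c c0 Ec] := homog_coords_scale (EF _ _ X1 (hc x y) F1) EP.
exists c, s, t, y'; split=> // i.
by have := congr1 (fun v : 'rV[k]_g.+3 => v 0 i) Ec; rewrite eF !mxE.
Qed.

Lemma row_neq0 (h : 'I_g.+3 -> k) i : h i != 0 -> \row_j h j != 0.
Proof. by apply: contraNneq => /rowP/(_ i); rewrite !mxE => ->. Qed.

(** Up to a common factor s and t are polynomials near the given point: they are
    the local coordinates of indices 0 and 1 if s != 0 (common factor s^g), and
    those of indices g and g + 1 if s = 0 (common factor t^g). Off the fibre
    over a the denominator t - a s does not vanish. *)
Lemma regular_inverse_shift a b x0 y0 : y0 ^+ 2 = (chart_poly g f1 b).[x0] ->
    (forall y, val (phi (point (chart g b x0 y0))) <> <[E 1 a y]>%VS) ->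
  regular_off (chart_poly g f1 b) 1 x0 y0
    (fun x y => inverse_shift a (phi (point (chart g b x y)))).
Proof.
move=> xy0 nofib; have [q [q0 Eq]] := local_polynomials xy0.
have qrow i x y : eval2 (q i) x y != 0 -> \row_j eval2 (q j) x y != 0.
  exact: (@row_neq0 (fun j => eval2 (q j) x y)).
have [c [s [t [y' [c0 st Ey' EP Ec]]]]] := Eq _ _ xy0 q0.
have ta : t - a * s != 0.
  have [s0|s0] := eqVneq s 0.
    by move: st; rewrite s0 eqxx mulr0 subr0.
  apply/eqP => /eqP; rewrite subr_eq0 => /eqP ta; apply: (nofib (y' / s ^+ g.+1)).
  by rewrite EP (weighted_affine _ _ _ s0) ta mulfK.
pose i0 : 'I_g.+3 := inord 0; pose i1 : 'I_g.+3 := inord 1.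
pose ig : 'I_g.+3 := inord g; pose ig1 : 'I_g.+3 := inord g.+1.
have [s0|s0] := eqVneq s 0.
  exists (q ig), (q ig1 - (a%:P)%:P * q ig); split.
    rewrite !eval2E !Ec /ig /ig1 weightedg weightedg1 s0 mul0r !mulr0 subr0.
    by rewrite mulf_neq0 ?expf_neq0 //; move: st; rewrite s0 eqxx.
  move=> x y xy _ ex.
  have qx : \row_i eval2 (q i) x y != 0.
    have [qg|/qrow //] := eqVneq (eval2 (q ig) x y) 0.
    move: ex; rewrite !eval2E qg mulr0 subr0; exact: qrow.
  have [c' [s' [t' [y'' [c'0 st' _ EP' Ec']]]]] := Eq _ _ xy qx.
  move: ex; rewrite !eval2E (inverse_shiftE _ EP') !Ec' /ig /ig1 weightedg weightedg1.
  rewrite (_ : _ - _ = c' * t' ^+ g * (t' - a * s')); last by rewrite exprS; ring.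
  by rewrite !mulf_eq0 !negb_or => /andP[_ ts']; field.
exists (q i0), (q i1 - (a%:P)%:P * q i0); split.
  rewrite !eval2E !Ec /i0 /i1 weighted0 weighted1.
  rewrite (_ : _ - _ = c * s ^+ g * (t - a * s)); last by rewrite exprS; ring.
  by rewrite !mulf_neq0 ?expf_neq0.
move=> x y xy _ ex.
have qx : \row_i eval2 (q i) x y != 0.
  have [qg|/qrow //] := eqVneq (eval2 (q i0) x y) 0.
  move: ex; rewrite !eval2E qg mulr0 subr0; exact: qrow.
have [c' [s' [t' [y'' [c'0 st' _ EP' Ec']]]]] := Eq _ _ xy qx.
move: ex; rewrite !eval2E (inverse_shiftE _ EP') !Ec' /i0 /i1 weighted0 weighted1.
rewrite (_ : _ - _ = c' * s' ^+ g * (t' - a * s')); last by rewrite exprS; ring.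
by rewrite !mulf_eq0 !negb_or exprS => /andP[_ ts']; field.
Qed.

End Morphisms.

(** * Poles of the pulled back function *)

(** If b != 0, then y + b is invertible at (a, b), and there x - a divides y - b,
    since (y + b)(y - b) = f(x) - f(a). So x - a divides every function that
    vanishes at (a, b). *)
Lemma uniformizer_factor (k : closedFieldType) (f : {poly k}) (p : {poly {poly k}}) a b :
    b ^+ 2 = f.[a] -> eval2 p a b = 0 ->
  exists h, forall x y, y ^+ 2 = f.[x] ->
    (y + b) * eval2 p x y = (x - a) * eval2 h x y.
Proof.
move=> ab p0; have [A [B E]] := eval2_mod_curve f p.
have fac (c : {poly k}) : exists h : {poly k}, forall x, c.[x] - c.[a] = (x - a) * h.[x].
  have /factor_theorem[h Eh] : root (c - c.[a]%:P) a by rewrite /root !hornerE subrr.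
  exists h => x; have := congr1 (fun c => c.[x]) Eh.
  by rewrite hornerM hornerXsubC hornerD hornerN hornerC mulrC.
have [A1 EA] := fac A; have [B1 EB] := fac B; have [f' Ef] := fac f.
have EAB : A.[a] = - (B.[a] * b) by apply/eqP; rewrite -addr_eq0 -(E _ _ ab) p0.
exists (('X + (b%:P)%:P) * (A1%:P + B1%:P * 'X) + (B.[a] *: f')%:P) => x y xy.
rewrite (E _ _ xy) !eval2E hornerZ.
have -> : A.[x] + B.[x] * y =
    (A.[x] - A.[a]) + (B.[x] - B.[a]) * y + B.[a] * (y - b) by rewrite EAB; ring.
transitivity ((y + b) * ((A.[x] - A.[a]) + (B.[x] - B.[a]) * y)
    + B.[a] * (y ^+ 2 - b ^+ 2)); first by ring.
by rewrite xy ab Ef EA EB; ring.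
Qed.

Lemma affine_local_polynomials (k : closedFieldType) g (f1 f2 : {poly k}) phi x0 y0 a b :
    (size f1 <= (2 * g).+3)%N -> (size f2 <= (2 * g).+3)%N ->
    is_morphism (hyperelliptic g f1) (hyperelliptic g f2) phi ->
    y0 ^+ 2 = f1.[x0] ->
    val (phi (point (chart g true x0 y0))) = <[weighted_coords g 1 a b]>%VS ->
  exists X Y d, eval2 d x0 y0 != 0 /\
    forall x y, y ^+ 2 = f1.[x] -> eval2 d x y != 0 ->
      (eval2 Y x y / eval2 d x y) ^+ 2 = f2.[eval2 X x y / eval2 d x y] /\
      val (phi (point (chart g true x y))) =
        <[weighted_coords g 1 (eval2 X x y / eval2 d x y) (eval2 Y x y / eval2 d x y)]>%VS.
Proof.
move=> sf1 sf2 phi_mor xy0 EP0.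
have [q [q0 Eq]] := local_polynomials sf1 phi_mor (b := true) xy0.
exists (q (inord 1)), (q ord_max), (q (inord 0)); split.
  have [c [s [t [y' [c0 st Ey' EP Ec]]]]] := Eq _ _ xy0 q0.
  move: EP; rewrite EP0 => /(weighted_inj _ st)[|c1 [c10 Es _ _]].
    by rewrite oner_neq0.
  by rewrite Ec weighted0 Es mulr1 mulf_neq0 ?expf_neq0.
move=> x y xy dx.
have qx : \row_i eval2 (q i) x y != 0 by apply: (@row_neq0 _ _ _ (inord 0)).
have [c [s [t [y' [c0 st Ey' EP Ec]]]]] := Eq _ _ xy qx.
have s0 : s != 0.
  by move: dx; rewrite Ec weighted0 mulf_eq0 expf_eq0 /= negb_or => /andP[].
have -> : eval2 (q (inord 1)) x y / eval2 (q (inord 0)) x y = t / s.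
  by rewrite !Ec weighted0 weighted1 exprS; field; rewrite s0 c0 expf_neq0.
have -> : eval2 (q ord_max) x y / eval2 (q (inord 0)) x y = y' / s ^+ g.+1.
  by rewrite !Ec weighted0 weightedY -mulf_div divff ?mul1r.
rewrite -weighted_affine // EP; split=> //.
rewrite -(binary_form_affine _ sf2) -[X in binary_form _ _ X _](mulVf s0).
rewrite [t / s]mulrC binary_form_scale.
rewrite exprMn Ey' !exprVn -exprM mulrC.
by rewrite [(g.+1 * 2)%N]mulnC mulnS add2n.
Qed.

(** At a point P0 mapped to (a, b) with b != 0, the function x - x0 vanishes, so
    it is the pullback by phi of a function vanishing at (a, b), which is a
    regular multiple of the uniformizer x' - a there. The inverse morphism psi
    is essential here: composing phi with the Frobenius map would give poles of
    higher order. *)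
Lemma simple_pole (k : closedFieldType) g (f1 f2 z : {poly k}) phi psi x0 y0 a b :
    2 != 0 :> k ->
    (size f1 <= (2 * g).+3)%N -> (size f2 <= (2 * g).+3)%N ->
    is_morphism (hyperelliptic g f1) (hyperelliptic g f2) phi ->
    is_morphism (hyperelliptic g f2) (hyperelliptic g f1) psi ->
    (forall P, hyperelliptic g f1 P -> psi (phi P) = P) ->
    y0 ^+ 2 = f1.[x0] -> b ^+ 2 = f2.[a] -> b != 0 ->
    val (phi (point (chart g true x0 y0))) = <[weighted_coords g 1 a b]>%VS ->
    (forall x y, y ^+ 2 = f1.[x] -> z.[x] != 0 -> forall b',
       val (phi (point (chart g true x y))) <> <[weighted_coords g 1 a b']>%VS) ->
  regular_off f1 z x0 y0
    (fun x y => (x - x0) * inverse_shift a (phi (point (chart g true x y)))).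
Proof.
move=> two0 sf1 sf2 phi_mor psi_mor psiK xy0 ab b0 EP0 nofib.
have [X [Y [d [d0 Ed]]]] := affine_local_polynomials sf1 sf2 phi_mor xy0 EP0.
have phiK0 : phi (point (chart g true x0 y0)) = point (chart g true a b).
  by apply/val_inj; rewrite EP0 val_point ?chart_neq0.
have EQ0 : val (psi (point (chart g true a b))) = <[weighted_coords g 1 x0 y0]>%VS.
  rewrite -phiK0 psiK ?val_point ?chart_neq0 //.
  exact: (hyperelliptic_chart sf1 (b := true)).
have [X2 [Y2 [d2 [d20 Ed2]]]] := affine_local_polynomials sf2 sf1 psi_mor ab EQ0.
have p0 : eval2 (X2 - (x0%:P)%:P * d2) a b = 0.
  have [_] := Ed2 _ _ ab d20; rewrite EQ0 => /weighted_affine_inj[-> _].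
  by rewrite !eval2E divfK // subrr.
have [h Eh] := uniformizer_factor ab p0.
have [nh [Nh Enh]] := eval2_comp_frac h X Y d.
have [n2 [N2 En2]] := eval2_comp_frac d2 X Y d.
have [Eab] := Ed _ _ xy0 d0; rewrite EP0 => /weighted_affine_inj[Ea Eb].
exists (nh * d ^+ N2.+2), (d ^+ Nh.+1 * n2 * (Y + (b%:P)%:P * d)); split.
  rewrite !eval2E -En2 // -Ea -Eb !mulf_neq0 ?expf_neq0 //.
  rewrite -[eval2 Y x0 y0](divfK d0) -Eb -mulrDl mulf_neq0 // -mulr2n -mulr_natl.
  by rewrite mulf_neq0.
move=> x y xy zx; rewrite !eval2E !mulf_eq0 !negb_or expf_eq0 /= => /andP[/andP[dx n2x] _].
have [Exy' EP] := Ed _ _ xy dx; move: Exy' EP n2x.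
have := Enh x y dx; have := En2 x y dx.
set x' := eval2 X x y / _; set y' := eval2 Y x y / _.
move=> E2 E1 Exy' EP; rewrite -E2 mulf_eq0 negb_or => /andP[d2x _].
have xa : x' - a != 0.
  rewrite subr_eq0; apply/eqP => xa.
  by apply: (nofib _ _ xy zx y'); rewrite EP xa.
have phiK1 : phi (point (chart g true x y)) = point (chart g true x' y').
  by apply/val_inj; rewrite EP val_point ?chart_neq0.
have [_] := Ed2 _ _ Exy' d2x; rewrite -phiK1 psiK; last first.
  exact: (hyperelliptic_chart sf1 (b := true)).
rewrite val_point ?chart_neq0 // => /weighted_affine_inj[/= Ex _].
have := Eh _ _ Exy'; rewrite !eval2E => Ex'.
have EX2 : eval2 X2 x' y' = x * eval2 d2 x' y' by rewrite Ex divfK.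
move: Ex'; rewrite EX2 => Ex'.
have EY : eval2 Y x y = y' * eval2 d x y by rewrite divfK.
rewrite (inverse_shiftE _ EP) mulr1 -E1 EY.
have -> : eval2 h x' y' = (y' + b) * (x * eval2 d2 x' y' - x0 * eval2 d2 x' y') / (x' - a).
  by rewrite Ex' mulrC mulKf.
by rewrite !exprS; field.
Qed.

Lemma regular_off_ext (k : closedFieldType) (f z : {poly k}) x0 y0 r r' :
  (forall x y, r x y = r' x y) -> regular_off f z x0 y0 r -> regular_off f z x0 y0 r'.
Proof.
move=> rr' [n [e [e0 E]]]; exists n, e; split=> // x y xy zx ex.
by rewrite -rr' E.
Qed.

(** The product of z with the regular function r vanishes where z does. *)
Lemma regular_times_zero (k : closedFieldType) (f z z' A : {poly k}) x0 y0 r :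
    2 != 0 :> k -> f != 0 -> z' != 0 -> y0 ^+ 2 = f.[x0] ->
    regular_off f 1 x0 y0 r ->
    (forall x y, y ^+ 2 = f.[x] -> z'.[x] != 0 -> z.[x] * r x y = A.[x]) ->
  z.[x0] = 0 -> A.[x0] = 0.
Proof.
move=> two0 f0 z'0 xy0 [n [e [e0 En]]] E zx0.
suff : eval2 (e * (e * A%:P - z%:P * n)) x0 y0 = 0.
  move/eqP; rewrite !eval2E zx0 mul0r subr0 !mulf_eq0 (negPf e0) => /eqP //.
apply: (curve_identity two0 z'0 f0) xy0 => x y xy zx; rewrite !eval2E.
have [->|ex] := eqVneq (eval2 e x y) 0; first by rewrite mul0r.
by rewrite -(E x y) // -En //; [ring | rewrite hornerC oner_neq0].
Qed.

Lemma hyperelliptic_coords (k : fieldType) g (f : {poly k}) P s t y :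
  hyperelliptic g f P -> (s != 0) || (t != 0) ->
  val P = <[weighted_coords g s t y]>%VS -> y ^+ 2 = binary_form g f s t.
Proof.
case/hyperellipticP=> s' [t' [y' [st' Ey' ->]]] st /(weighted_inj st' st)[c [c0 -> -> ->]].
rewrite binary_form_scale exprMn Ey' -exprM.
by rewrite [(g.+1 * 2)%N]mulnC mulnS add2n.
Qed.

(** * Isomorphisms are Moebius transformations on the line *)

Section Mobius.
Variables (k : closedFieldType) (g : nat) (f1 f2 : {poly k}).
Hypotheses (two_neq0 : 2 != 0 :> k) (g_ge2 : (2 <= g)%N).
Hypotheses (size_f1 : size f1 = (2 * g).+3) (sep_f1 : coprimep f1 f1^`()).
Hypotheses (size_f2 : size f2 = (2 * g).+3).
Variables phi psi : projspace k g.+2 -> projspace k g.+2.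
Hypotheses (phi_mor : is_morphism (hyperelliptic g f1) (hyperelliptic g f2) phi).
Hypotheses (psi_mor : is_morphism (hyperelliptic g f2) (hyperelliptic g f1) psi).
Hypotheses (phiK : forall P, hyperelliptic g f1 P -> psi (phi P) = P).
Hypotheses (psiK : forall P, hyperelliptic g f2 P -> phi (psi P) = P).

Local Notation E := (weighted_coords g).

Let le_f1 : (size f1 <= (2 * g).+3)%N. Proof. by rewrite size_f1. Qed.
Let le_f2 : (size f2 <= (2 * g).+3)%N. Proof. by rewrite size_f2. Qed.
Let f1_neq0 : f1 != 0. Proof. by rewrite -size_poly_gt0 size_f1. Qed.
Let f2_neq0 : f2 != 0. Proof. by rewrite -size_poly_gt0 size_f2. Qed.
Let lead_f1 : f1`_(2 * g).+2 != 0.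
Proof. by have := f1_neq0; rewrite -lead_coef_eq0 lead_coefE size_f1. Qed.
Let simple_roots_f1 x : f1.[x] = 0 -> f1^`().[x] != 0.
Proof. by move=> /eqP; apply: coprimep_root. Qed.

Definition fibre a b x y b' : Prop :=
  val (phi (point (chart g b x y))) = <[E 1 a b']>%VS.

(** Each condition excludes finitely many values of a. They ensure that the fibre
    has two points, that these correspond to affine points of the first curve,
    and that the latter are moved by the involution y |-> - y. *)
Lemma exists_good_fibre : exists a, [/\ f2.[a] != 0,
  forall v b', v ^+ 2 = (chart_poly g f1 false).[0] -> ~ fibre a false 0 v b' &
  forall x b', f1.[x] = 0 -> ~ fibre a true x 0 b'].
Proof.
have [rs Ers] := closed_field_poly_normal f1.
have [w Ew] := exists_sqrt (chart_poly g f1 false).[0].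
pose bad := [seq point (chart g true x 0) | x <- rs]
  ++ [:: point (chart g false 0 w); point (chart g false 0 (- w))].
pose cx (P : projspace k g.+2) : k :=
  let v := vpick (val P) in v 0 (inord 1) / v 0 (inord 0).
have cxE P a b : val P = <[E 1 a b]>%VS -> cx P = a.
  move=> /(homog_coords_scale (vpick_homog_coords P))[c c0 Ev].
  have vE i : vpick (val P) 0 i = c * E 1 a b 0 i by rewrite Ev mxE.
  by rewrite /cx !vE weighted0 weighted1 !expr1n mul1r mulr1 mulrC mulKf.
have /closed_nonrootP[a] : f2 * \prod_(P <- bad) ('X - (cx (phi P))%:P) != 0.
  by rewrite mulf_neq0 // monic_neq0 ?monic_prod_XsubC.
rewrite /root hornerM mulf_eq0 negb_or => /andP[f2a].
rewrite -/(root _ _) -(big_map (fun P => cx (phi P)) xpredT (fun c => 'X - c%:P)).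
rewrite root_prod_XsubC => bad_a.
have nobad P b : P \in bad -> val (phi P) <> <[E 1 a b]>%VS.
  by move=> Pbad /cxE Ea; move/mapP: bad_a; apply; exists P.
exists a; split=> // [v b' Ev|x b' fx].
  apply: nobad; rewrite mem_cat !inE.
  have : (v - w) * (v + w) == 0 by rewrite -subr_sqr Ev Ew subrr.
  rewrite mulf_eq0 subr_eq0 addr_eq0 => /orP[] /eqP->; rewrite eqxx ?orbT //.
apply: nobad; rewrite mem_cat; apply/orP; left.
apply/mapP; exists x => //; rewrite -root_prod_XsubC.
have : root f1 x by apply/eqP.
by rewrite {1}Ers rootZ ?lead_coef_eq0.
Qed.

Section Fibre.
Variable a : k.
Hypotheses (f2a : f2.[a] != 0)
  (no_infinity : forall v b', v ^+ 2 = (chart_poly g f1 false).[0] ->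
     ~ fibre a false 0 v b')
  (no_branch : forall x b', f1.[x] = 0 -> ~ fibre a true x 0 b').

Lemma fibre_preimage b : b ^+ 2 = f2.[a] -> exists x y,
  [/\ y ^+ 2 = f1.[x], y != 0 & fibre a true x y b].
Proof.
move=> ab; have := psi_mor.1 _ (hyperelliptic_chart le_f2 (b := true) ab).
set Q := point _; have EQ : val Q = <[E 1 a b]>%VS by rewrite val_point ?chart_neq0.
have phiQ : phi (psi Q) = Q.
  by apply: psiK; apply: (hyperelliptic_chart le_f2 (b := true)).
move=> X1; have [s [t [y [st Ey EP]]]] := (hyperellipticP _ _).1 X1.
have [s0|s0] := eqVneq s 0.
  have t0 : t != 0 by move: st; rewrite s0 eqxx.
  have tg : t ^+ g.+1 != 0 by rewrite expf_neq0.
  have EP' : psi Q = point (chart g false 0 (y / t ^+ g.+1)).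
    apply/val_inj; rewrite EP val_point ?chart_neq0 // -[RHS](line_scale _ tg).
    by rewrite -weighted_scale mulr0 mulr1 mulrC divfK // s0.
  case: (@no_infinity (y / t ^+ g.+1) b); last by rewrite /fibre -EP' phiQ.
  have X1' := X1; rewrite EP' in X1'.
  rewrite -(binary_form_chart false _ le_f1).
  by apply: (hyperelliptic_coords X1'); rewrite ?chart_st ?val_point ?chart_neq0.
have EP' : psi Q = point (chart g true (t / s) (y / s ^+ g.+1)).
  by apply/val_inj; rewrite EP val_point ?chart_neq0 // weighted_affine.
have xy : (y / s ^+ g.+1) ^+ 2 = f1.[t / s].
  have X1' := X1; rewrite EP' in X1'.
  rewrite -(binary_form_chart true _ le_f1).
  by apply: (hyperelliptic_coords X1'); rewrite ?chart_st ?val_point ?chart_neq0.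
have fib : fibre a true (t / s) (y / s ^+ g.+1) b by rewrite /fibre -EP' phiQ.
exists (t / s), (y / s ^+ g.+1); split=> //.
apply/eqP => y0; move: fib; rewrite y0; apply: no_branch.
by rewrite -xy y0 expr0n.
Qed.

Lemma fibre_eq x y x' y' b : y ^+ 2 = f1.[x] -> y' ^+ 2 = f1.[x'] ->
  fibre a true x y b -> fibre a true x' y' b -> x = x' /\ y = y'.
Proof.
move=> xy xy' F F'; apply: (@weighted_affine_inj _ g).
rewrite -[LHS](val_point (chart_neq0 g true x y)).
rewrite -[RHS](val_point (chart_neq0 g true x' y')); congr val.
have E12 : phi (point (chart g true x y)) = phi (point (chart g true x' y')).
  by apply/val_inj; rewrite F F'.
have := phiK (hyperelliptic_chart le_f1 (b := true) xy).
by rewrite E12 (phiK (hyperelliptic_chart le_f1 (b := true) xy')) => ->.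
Qed.

Lemma fibre_ordinate x y b : y ^+ 2 = f1.[x] -> fibre a true x y b -> b ^+ 2 = f2.[a].
Proof.
move=> xy F; have := phi_mor.1 _ (hyperelliptic_chart le_f1 (b := true) xy).
move=> /hyperelliptic_coords/(_ _ F); rewrite oner_neq0 => /(_ isT) ->.
by rewrite binary_form_affine.
Qed.

Let r x y := inverse_shift a (phi (point (chart g true x y))).

(** At (x0, y0) the function X / d = x' o phi takes the value a, so that
    1 / r = X / d - a vanishes there; but it would be the inverse of a constant. *)
Lemma inverse_shift_nonconstant x0 y0 b z c :
    y0 ^+ 2 = f1.[x0] -> fibre a true x0 y0 b -> z != 0 ->
    (forall x y b', y ^+ 2 = f1.[x] -> z.[x] != 0 -> ~ fibre a true x y b') ->
  ~ (forall x y, y ^+ 2 = f1.[x] -> z.[x] != 0 -> r x y = c).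
Proof.
move=> xy0 F0 z0 nofib Er.
have [X [Y [d [d0 Ed]]]] := affine_local_polynomials le_f1 le_f2 phi_mor xy0 F0.
have [_] := Ed _ _ xy0 d0; rewrite F0 => /weighted_affine_inj[Ea _].
suff : eval2 (d * ((c%:P)%:P * (X - (a%:P)%:P * d) - d)) x0 y0 = 0.
  move/eqP; rewrite !eval2E {1}Ea divfK // subrr mulr0 sub0r mulf_eq0 oppr_eq0.
  by rewrite (negPf d0).
apply: (curve_identity two_neq0 z0 f1_neq0) xy0 => x y xy zx; rewrite !eval2E.
have [->|dx] := eqVneq (eval2 d x y) 0; first by rewrite mul0r.
have [_ EP] := Ed _ _ xy dx.
have xa : eval2 X x y / eval2 d x y - a != 0.
  rewrite subr_eq0; apply/eqP => xa.
  by apply: (nofib _ _ (eval2 Y x y / eval2 d x y) xy zx); rewrite /fibre EP xa.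
have := Er _ _ xy zx; rewrite /r (inverse_shiftE _ EP) mulr1 => <-.
have -> : eval2 X x y - a * eval2 d x y =
  eval2 d x y * (eval2 X x y / eval2 d x y - a) by field.
by rewrite mul1r mulrCA mulVf // mulr1 subrr mulr0.
Qed.

(** The relation (x - x0) / (x' - a) = A(x), with A of degree at most 1, solved for
    x' = t / s. The determinant is - A(x0), which is nonzero since r would be
    constant if A were a multiple of x - x0. *)
Lemma mobius_generic : exists (a0 a1 b0 b1 : k) (z : {poly k}),
  [/\ a1 * b0 - a0 * b1 != 0, z != 0 &
  forall (x y s t y' : k), y ^+ 2 = f1.[x] -> z.[x] != 0 -> (s != 0) || (t != 0) ->
    val (phi (point (chart g true x y))) = <[E s t y']>%VS ->
    t * (a0 + a1 * x) = s * (b0 + b1 * x)].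
Proof.
have [b ab] := exists_sqrt f2.[a].
have b0 : b != 0 by apply: contraNneq f2a => b0; rewrite -ab b0 expr0n.
have [x0 [y0 [xy0 y00 F0]]] := fibre_preimage ab.
have ab' : (- b) ^+ 2 = f2.[a] by rewrite sqrrN.
have b0' : - b != 0 by rewrite oppr_eq0.
have [x1 [y1 [xy1 y10 F1]]] := fibre_preimage ab'.
have fibP x y b' : y ^+ 2 = f1.[x] -> fibre a true x y b' ->
    x = x0 /\ y = y0 \/ x = x1 /\ y = y1.
  move=> xy F; have : (b' - b) * (b' + b) == 0.
    by rewrite -subr_sqr (fibre_ordinate xy F) ab subrr.
  rewrite mulf_eq0 subr_eq0 addr_eq0 => /orP[] /eqP Eb; rewrite Eb in F.
    by left; apply: fibre_eq F F0.
  by right; apply: fibre_eq F F1.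
have pole (L : seq k) : (size L <= 2)%N -> (x0 \in L) -> (x1 \in L) ->
    let z := \prod_(l <- L) ('X - l%:P) in
    exists (A z' : {poly k}), [/\ z' != 0, (size A <= (size L).+1)%N,
      forall x y b', y ^+ 2 = f1.[x] -> z'.[x] != 0 -> ~ fibre a true x y b' &
      forall x y, y ^+ 2 = f1.[x] -> z'.[x] != 0 -> z.[x] * r x y = A.[x]].
  move=> sL x0L x1L z.
  have zP x : (z.[x] == 0) = (x \in L) by rewrite -root_prod_XsubC.
  have nofib x y : y ^+ 2 = f1.[x] -> z.[x] != 0 -> forall b', ~ fibre a true x y b'.
    by move=> xy; rewrite zP => xL b' /(fibP _ _ _ xy)[] [Ex _];
      move: xL; rewrite Ex ?x0L ?x1L.
  have [||||A [z' [z'0 sA z'z EA]]] := @few_poles_polynomial k two_neq0 g f1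
    f1_neq0 le_f1 lead_f1 simple_roots_f1 L r
    (fun u v => inverse_shift a (phi (point (chart g false u v)))).
  + exact: leq_trans g_ge2.
  + move=> x y xy.
    have simple x2 y2 b2 : x2 \in L -> y2 ^+ 2 = f1.[x2] -> b2 ^+ 2 = f2.[a] ->
        b2 != 0 -> fibre a true x2 y2 b2 ->
        regular_off f1 z x2 y2 (fun x y => z.[x] * r x y).
      move=> x2L xy2 ab2 b20 F2.
      have /factor_theorem[c Ec] : root z x2 by rewrite /root zP.
      have := simple_pole two_neq0 le_f1 le_f2 phi_mor psi_mor phiK xy2 ab2 b20 F2 nofib.
      move=> H; apply: regular_off_ext (regular_off_mul (z' := z) c (fun=> id) H).
      by move=> x3 y3; rewrite Ec hornerM hornerXsubC mulrA.
    have [/andP[/eqP-> /eqP->]|n0] := boolP ((x == x0) && (y == y0)).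
      exact: simple F0.
    have [/andP[/eqP-> /eqP->]|n1] := boolP ((x == x1) && (y == y1)).
      exact: simple F1.
    apply: (@regular_off_mul _ _ 1); first by move=> u _; rewrite hornerC oner_neq0.
    apply: (regular_inverse_shift le_f1 phi_mor (b := true) xy) => b'.
    by move=> /(fibP _ _ _ xy)[] [Ex Ey]; move: n0 n1; rewrite Ex Ey !eqxx.
  + move=> v xy; apply: (regular_inverse_shift le_f1 phi_mor (b := false) xy) => b'.
    exact: no_infinity.
  + by move=> u v u0 _; rewrite (chart_flip _ _ u0).
  by exists A, z'; split=> // x y b' xy zx; apply: nofib => //; apply: z'z.
have [E01|n01] := eqVneq x0 x1; last first.
  (* The opposites of the two poles are not poles, so A vanishes at x0 and x1. *)
  have [|||A [z' [z'0 sA nofib EA]]] := pole [:: x0; x1]; rewrite ?inE ?eqxx ?orbT //.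
  have zero x2 y2 : y2 ^+ 2 = f1.[x2] -> (x2 == x0) || (x2 == x1) -> y2 != 0 ->
      ((x2 == x0) && (y2 == y0)) || ((x2 == x1) && (y2 == y1)) -> A.[x2] = 0.
    move=> xy2 x2L y20 P2.
    have xy2' : (- y2) ^+ 2 = f1.[x2] by rewrite sqrrN.
    have y2N : - y2 != y2.
      by rewrite eq_sym -addr_eq0 -mulr2n -mulr_natl mulf_neq0.
    apply: (regular_times_zero two_neq0 f1_neq0 z'0 xy2' _ EA); last first.
      by apply/eqP; rewrite -/(root _ _) root_prod_XsubC !inE.
    apply: (regular_inverse_shift le_f1 phi_mor (b := true) xy2') => b'.
    move=> /(fibP _ _ _ xy2')[] [Ex Ey]; move: P2; rewrite -Ey Ex ?eqxx.
      by rewrite (negPf n01) orbF /= eq_sym (negPf y2N).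
    by rewrite [x1 == x0]eq_sym (negPf n01) /= eq_sym (negPf y2N).
  have Ax0 : A.[x0] = 0 by apply: (zero x0 y0); rewrite ?eqxx.
  have Ax1 : A.[x1] = 0 by apply: (zero x1 y1); rewrite ?eqxx ?orbT.
  have /dvdpP[c Ec] : \prod_(l <- [:: x0; x1]) ('X - l%:P) %| A.
    apply: uniq_roots_dvdp; first by rewrite /= /root Ax0 Ax1 !eqxx.
    by rewrite uniq_rootsE /= inE n01.
  have /size1_polyC Ec' : (size c <= 1)%N.
    have [-> | c0] := eqVneq c 0; first by rewrite size_poly0.
    move: sA; rewrite Ec size_Mmonic ?monic_prod_XsubC // size_prod_XsubC /=.
    by rewrite addn3 /= !ltnS.
  case: (@inverse_shift_nonconstant x0 y0 b
    (z' * \prod_(l <- [:: x0; x1]) ('X - l%:P)) c`_0 xy0 F0).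
  - by rewrite mulf_neq0 // monic_neq0 ?monic_prod_XsubC.
  - move=> x y b' xy; rewrite hornerM mulf_eq0 negb_or => /andP[zx _]; exact: nofib.
  move=> x y xy; rewrite hornerM mulf_eq0 negb_or => /andP[zx zx'].
  by apply: (mulfI zx'); rewrite (EA _ _ xy zx) {1}Ec Ec' hornerM hornerC mulrC coefC.
have [|||A [z' [z'0 sA nofib EA]]] := pole [:: x0]; rewrite ?inE ?E01 //.
have EA' x : A.[x] = A`_0 + A`_1 * x.
  by rewrite (horner_coef_wide _ sA) !big_ord_recl big_ord0 /= mulr1 expr1 addr0.
exists A`_0, A`_1, (- x0 + a * A`_0), (1 + a * A`_1), z'; split=> //.
  rewrite (_ : _ - _ = - (A`_0 + A`_1 * x0)); last by ring.
  rewrite oppr_eq0 -EA'; apply/eqP => Ax0.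
  apply: (@inverse_shift_nonconstant x0 y0 b (z' * ('X - x0%:P)) A`_1 xy0 F0).
  - by rewrite mulf_neq0 ?polyXsubC_eq0.
  - move=> x y b' xy; rewrite hornerM mulf_eq0 negb_or => /andP[zx _]; exact: nofib.
  move=> x y xy; rewrite hornerM hornerXsubC mulf_eq0 negb_or => /andP[zx xx0].
  apply: (mulfI xx0); have := EA _ _ xy zx; rewrite big_seq1 hornerXsubC => ->.
  by transitivity (A.[x] - A.[x0]); [rewrite Ax0 subr0 | rewrite !EA'; ring].
move=> x y s t y' xy zx st EP.
have ts : t - a * s != 0.
  apply/eqP => /eqP; rewrite subr_eq0 => /eqP ta.
  have s0 : s != 0 by apply: contraTneq st => s0; rewrite ta s0 mulr0 eqxx.
  apply: (nofib _ _ (y' / s ^+ g.+1) xy zx).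
  by rewrite /fibre EP (weighted_affine _ _ _ s0) ta mulfK.
have := EA _ _ xy zx; rewrite big_seq1 hornerXsubC /r (inverse_shiftE _ EP) EA' => H.
have : (x - x0) * s = (t - a * s) * (A`_0 + A`_1 * x) by rewrite -H; field.
move=> {}H; apply/eqP; rewrite -subr_eq0; apply/eqP.
transitivity ((t - a * s) * (A`_0 + A`_1 * x) - (x - x0) * s); first by ring.
by rewrite H subrr.
Qed.

End Fibre.

End Mobius.

(** Near a point, the relation multiplied by s^g or by t^g is an identity between
    polynomials, so that it spreads from a dense set; one of s^g and t^g is
    nonzero at the point. *)
Lemma mobius_everywhere (k : closedFieldType) g (f1 f2 z : {poly k}) phi c
    (a0 a1 b0 b1 : k) :
    2 != 0 :> k -> (size f1 <= (2 * g).+3)%N -> chart_poly g f1 c != 0 ->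
    is_morphism (hyperelliptic g f1) (hyperelliptic g f2) phi -> z != 0 ->
    (forall (x y s t y' : k), y ^+ 2 = (chart_poly g f1 c).[x] -> z.[x] != 0 ->
       (s != 0) || (t != 0) ->
       val (phi (point (chart g c x y))) = <[weighted_coords g s t y']>%VS ->
       t * (a0 * chart_s c x + a1 * chart_t c x)
         = s * (b0 * chart_s c x + b1 * chart_t c x)) ->
  forall (x y s t y' : k), y ^+ 2 = (chart_poly g f1 c).[x] ->
    (s != 0) || (t != 0) ->
    val (phi (point (chart g c x y))) = <[weighted_coords g s t y']>%VS ->
    t * (a0 * chart_s c x + a1 * chart_t c x)
      = s * (b0 * chart_s c x + b1 * chart_t c x).
Proof.
move=> two0 sf1 f0 phi_mor z0 gen x0 y0 s0 t0 y0' xy0 st0 EP0.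
pose l (d0 d1 : k) := d0%:P * (if c then 1 else 'X) + d1%:P * (if c then 'X else 1).
have lE d0 d1 x : (l d0 d1).[x] = d0 * chart_s c x + d1 * chart_t c x.
  by rewrite hornerD !hornerM !hornerC /chart_s /chart_t; case: (c); rewrite hornerC hornerX.
have [q [q0 Eq]] := local_polynomials sf1 phi_mor xy0.
have [e0 [s1 [t1 [y1 [e0n st1 _ EP1 Ec1]]]]] := Eq _ _ xy0 q0.
have vanish i j (m : k -> k -> k) : (forall s t y',
      weighted_coords g s t y' 0 i = m s t * s /\
      weighted_coords g s t y' 0 j = m s t * t) ->
    m s1 t1 * (t1 * (l a0 a1).[x0] - s1 * (l b0 b1).[x0]) = 0.
  move=> Em; have wi s t y' := (Em s t y').1; have wj s t y' := (Em s t y').2.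
  have : eval2 (q j * (l a0 a1)%:P - q i * (l b0 b1)%:P) x0 y0 = 0.
    apply: (curve_identity two0 z0 f0) xy0 => x y xy zx.
    rewrite eval2D eval2N !eval2M !eval2C.
    have [r0|r0] := eqVneq (\row_i eval2 (q i) x y) 0.
      have r i' : eval2 (q i') x y = 0.
        by have /rowP/(_ i') := r0; rewrite !mxE.
      by rewrite !r !mul0r subrr.
    have [e [s [t [y' [en st _ EP Ec]]]]] := Eq _ _ xy r0.
    have := gen _ _ _ _ _ xy zx st EP; rewrite -!lE !Ec wi wj => H.
    transitivity (e * m s t * (t * (l a0 a1).[x] - s * (l b0 b1).[x])); first by ring.
    by rewrite H subrr mulr0.
  rewrite eval2D eval2N !eval2M !eval2C !Ec1 wi wj => H; apply: (mulfI e0n).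
  by rewrite mulr0 -H; ring.
have rel1 : t1 * (l a0 a1).[x0] - s1 * (l b0 b1).[x0] = 0.
  have [s10|s10] := eqVneq s1 0.
    have t10 : t1 != 0 by move: st1; rewrite s10 eqxx.
    have /eqP := vanish (inord g) (inord g.+1) (fun _ t => t ^+ g) (fun s t y' =>
      conj (etrans (weightedg g s t y') (mulrC _ _)) (etrans (weightedg1 g s t y') (exprSr _ _))).
    by rewrite mulf_eq0 expf_eq0 (negPf t10) andbF => /eqP.
  have /eqP := vanish (inord 0) (inord 1) (fun s _ => s ^+ g) (fun s t y' =>
    conj (etrans (weighted0 g s t y') (exprSr _ _)) (weighted1 g s t y')).
  by rewrite mulf_eq0 expf_eq0 (negPf s10) andbF => /eqP.
rewrite -!lE; move: EP1; rewrite EP0 => /(weighted_inj st0 st1)[d [d0 Es Et _]].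
apply/eqP; rewrite -subr_eq0; apply/eqP/(mulfI d0); rewrite mulr0 -rel1 Es Et.
by ring.
Qed.

Section MobiusOnCurve.
Variables (k : closedFieldType) (g : nat) (f1 f2 : {poly k}).
Hypotheses (two_neq0 : 2 != 0 :> k) (g_ge2 : (2 <= g)%N).
Hypotheses (size_f1 : size f1 = (2 * g).+3) (sep_f1 : coprimep f1 f1^`()).
Hypotheses (size_f2 : size f2 = (2 * g).+3).
Variables phi psi : projspace k g.+2 -> projspace k g.+2.
Hypotheses (phi_mor : is_morphism (hyperelliptic g f1) (hyperelliptic g f2) phi).
Hypotheses (psi_mor : is_morphism (hyperelliptic g f2) (hyperelliptic g f1) psi).
Hypotheses (phiK : forall P, hyperelliptic g f1 P -> psi (phi P) = P).
Hypotheses (psiK : forall P, hyperelliptic g f2 P -> phi (psi P) = P).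

Local Notation E := (weighted_coords g).

Lemma isomorphism_mobius : exists a0 a1 b0 b1 : k, a1 * b0 - a0 * b1 != 0 /\
  forall P (s t y s' t' y' : k), hyperelliptic g f1 P ->
    (s != 0) || (t != 0) -> val P = <[E s t y]>%VS ->
    (s' != 0) || (t' != 0) -> val (phi P) = <[E s' t' y']>%VS ->
    t' * (a0 * s + a1 * t) = s' * (b0 * s + b1 * t).
Proof.
have le_f1 : (size f1 <= (2 * g).+3)%N by rewrite size_f1.
have f1_neq0 : f1 != 0 by rewrite -size_poly_gt0 size_f1.
have [a [f2a noinf nobr]] := exists_good_fibre size_f1 size_f2 phi.
have [a0 [a1 [b0 [b1 [z [det z0 gen]]]]]] := mobius_generic two_neq0 g_ge2
  size_f1 sep_f1 size_f2 phi_mor psi_mor phiK psiK f2a noinf nobr.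
exists a0, a1, b0, b1; split=> // P s t y s' t' y' XP st EP st' EQ.
have Ey := hyperelliptic_coords XP st EP.
have frev0 : chart_poly g f1 false != 0 by apply: reverse_poly_neq0.
have [s0|s0] := eqVneq s 0; last first.
  have EP' : P = point (chart g true (t / s) (y / s ^+ g.+1)).
    by apply/val_inj; rewrite EP val_point ?chart_neq0 // weighted_affine.
  have xy : (y / s ^+ g.+1) ^+ 2 = (chart_poly g f1 true).[t / s].
    have XP' := XP; rewrite EP' in XP'; rewrite -(binary_form_chart true _ le_f1).
    by apply: (hyperelliptic_coords XP'); rewrite ?chart_st ?val_point ?chart_neq0.
  rewrite EP' in EQ.
  have := mobius_everywhere (c := true) (a0 := a0) (a1 := a1) (b0 := b0) (b1 := b1)
    two_neq0 le_f1 f1_neq0 phi_mor z0 _ xy st' EQ.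
  rewrite /= !mulr1 => H; apply: (mulIf (invr_neq0 s0)).
  have {}H : t' * (a0 + a1 * (t / s)) = s' * (b0 + b1 * (t / s)).
    apply: H => x1 y1 s1 t1 y1' xy1 zx1 st1 EP1.
    exact: (gen _ _ _ _ _ xy1 zx1 st1 EP1).
  rewrite (_ : _ / s = t' * (a0 + a1 * (t / s))); last by field.
  by rewrite H; field.
have t0 : t != 0 by move: st; rewrite s0 eqxx.
have tg : t ^+ g.+1 != 0 by rewrite expf_neq0.
have EP' : P = point (chart g false 0 (y / t ^+ g.+1)).
  apply/val_inj; rewrite EP val_point ?chart_neq0 // -[RHS](line_scale _ tg).
  by rewrite -weighted_scale mulr0 mulr1 mulrC divfK // s0.
have xy : (y / t ^+ g.+1) ^+ 2 = (chart_poly g f1 false).[0].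
  have XP' := XP; rewrite EP' in XP'; rewrite -(binary_form_chart false _ le_f1).
  by apply: (hyperelliptic_coords XP'); rewrite ?chart_st ?val_point ?chart_neq0.
rewrite EP' in EQ.
have zz0 : 'X * reverse_poly (size z) z != 0.
  by rewrite mulf_neq0 ?polyX_eq0 // reverse_poly_neq0.
have := mobius_everywhere (c := false) (a0 := a0) (a1 := a1) (b0 := b0) (b1 := b1)
  two_neq0 le_f1 frev0 phi_mor zz0 _ xy st' EQ.
rewrite /= !mulr0 !mulr1 !add0r s0 !mulr0 !add0r !mulrA => -> //.
move=> u v s1 t1 y1' uv; rewrite hornerM hornerX mulf_eq0 negb_or => /andP[u0].
rewrite horner_reverse // mulf_eq0 negb_or => /andP[_ zu] st1.
rewrite (chart_flip _ _ u0) => EP1.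
have xy1 : (v / u ^+ g.+1) ^+ 2 = f1.[u^-1].
  rewrite exprMn exprVn uv /= horner_reverse // -exprM.
  rewrite [(g.+1 * 2)%N]mulnC mulnS add2n.
  by rewrite mulrAC divff ?mul1r // expf_neq0.
have H := gen _ _ _ _ _ xy1 zu st1 EP1; apply: (mulIf (invr_neq0 u0)).
rewrite (_ : _ / u = t1 * (a0 + a1 / u)); last by field.
by rewrite H; field.
Qed.

(** Suppose that a branch point P is mapped to a point (s : t : y) with y != 0.
    Then (s : t : -y) is the image of a point R with the same abscissa as P,
    because Moebius transformations are injective. As P is alone in its fibre,
    R = P, hence y = - y. *)
Lemma branch_points_correspond : exists a0 a1 b0 b1 : k, a1 * b0 - a0 * b1 != 0 /\
  forall x, f1.[x] = 0 -> binary_form g f2 (a0 + a1 * x) (b0 + b1 * x) = 0.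
Proof.
have le_f1 : (size f1 <= (2 * g).+3)%N by rewrite size_f1.
have [a0 [a1 [b0 [b1 [det rel]]]]] := isomorphism_mobius.
exists a0, a1, b0, b1; split=> // x fx.
have xy : 0 ^+ 2 = (chart_poly g f1 true).[x] by rewrite fx expr0n.
have X1 := hyperelliptic_chart le_f1 xy.
have [s [t [y [st Ey EQ]]]] := (hyperellipticP _ _).1 (phi_mor.1 _ X1).
have EP : val (point (chart g true x 0)) = <[E 1 x 0]>%VS.
  by rewrite val_point ?chart_neq0.
have relx := rel _ _ _ _ _ _ _ X1 (chart_st true x) EP st EQ.
rewrite /= !mulr1 in relx.
have y0 : y = 0.
  apply/eqP; apply: contraT => y0.
  have Ey' : (- y) ^+ 2 = binary_form g f2 s t by rewrite sqrrN.
  have X2 := hyperelliptic_point st Ey'.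
  have XR := psi_mor.1 _ X2.
  have [s2 [t2 [y2 [st2 Ey2 ER]]]] := (hyperellipticP _ _).1 XR.
  have EQ' : val (phi (psi (point (E s t (- y))))) = <[E s t (- y)]>%VS.
    by rewrite psiK // val_point ?weighted_neq0.
  have relR := rel _ _ _ _ _ _ _ XR st2 ER st EQ'.
  (* Injectivity of the transformation: det * (s2 * x - t2) vanishes, s or t being
     nonzero. *)
  have t2E : t2 = s2 * x.
    apply/eqP; rewrite eq_sym -subr_eq0; apply/eqP/(mulfI det); rewrite mulr0.
    have [s0|s0] := eqVneq s 0.
      have t0 : t != 0 by move: st; rewrite s0 eqxx.
      apply: (mulfI t0); rewrite mulr0.
      transitivity ((b0 * s2 + b1 * t2) * (t * (a0 + a1 * x)) -
        (b0 + b1 * x) * (t * (a0 * s2 + a1 * t2))); last first.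
        by rewrite relx relR; ring.
      by ring.
    apply: (mulfI s0); rewrite mulr0.
    transitivity ((a0 * s2 + a1 * t2) * - (s * (b0 + b1 * x)) +
      (a0 + a1 * x) * (s * (b0 * s2 + b1 * t2))); last first.
      by rewrite -relx -relR; ring.
    by ring.
  have s20 : s2 != 0 by apply: contraTneq st2 => s20; rewrite t2E s20 mul0r eqxx.
  have y20 : y2 = 0.
    apply/eqP; rewrite -sqrf_eq0 Ey2 -/(binary_form g f1 s2 t2) t2E.
    rewrite -[X in binary_form _ _ X _]mulr1.
    by rewrite binary_form_scale binary_form_affine // fx mulr0.
  have ERP : psi (point (E s t (- y))) = point (chart g true x 0).
    apply/val_inj; rewrite ER val_point ?chart_neq0 //.
    by rewrite weighted_affine // t2E y20 mul0r mulrC mulKf.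
  move: EQ'; rewrite ERP EQ => /(weighted_inj st st)[d [d0 Es Et Ed]].
  have d1 : d = 1.
    have [s0|s0] := eqVneq s 0; last by apply: (mulIf s0); rewrite mul1r -Es.
    have t0 : t != 0 by move: st; rewrite s0 eqxx.
    by apply: (mulIf t0); rewrite mul1r -Et.
  move: Ed; rewrite d1 expr1n mul1r => /eqP.
  by rewrite eq_sym -addr_eq0 -mulr2n -mulr_natl mulf_eq0 (negPf two_neq0) (negPf y0).
have Fst : binary_form g f2 s t = 0 by rewrite /binary_form -Ey y0 expr0n.
have [s0|s0] := eqVneq s 0.
  have t0 : t != 0 by move: st; rewrite s0 eqxx.
  have -> : a0 + a1 * x = (b0 + b1 * x) / t * s.
    by apply: (mulfI t0); rewrite relx s0 mul0r !mulr0.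
  have -> : b0 + b1 * x = (b0 + b1 * x) / t * t by rewrite divfK.
  by rewrite (mulfK t0) binary_form_scale Fst mulr0.
have -> : b0 + b1 * x = (a0 + a1 * x) / s * t.
  by apply: (mulfI s0); rewrite -relx; field.
have {1}-> : a0 + a1 * x = (a0 + a1 * x) / s * s by rewrite divfK.
by rewrite binary_form_scale Fst mulr0.
Qed.

End MobiusOnCurve.

(** * Transformations between pairs of regular pentagons *)

Section TwoPentagons.
Variable k : closedFieldType.
Implicit Types (l a b c e s t x : k).

Definition two_pentagons l : {poly k} := ('X^5 - 1) * ('X^5 - l%:P).

Lemma two_pentagonsE l :
  two_pentagons l = 'X^10 - (1 + l)%:P * 'X^5 + l%:P.
Proof. by rewrite /two_pentagons polyCD polyC1; ring. Qed.

Lemma horner_two_pentagons l x : (two_pentagons l).[x] = (x ^+ 5 - 1) * (x ^+ 5 - l).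
Proof. by rewrite !hornerE. Qed.

Lemma two_pentagons_monic l : two_pentagons l \is monic.
Proof. by rewrite monicMl monicXnsubC. Qed.

Lemma size_two_pentagons l : size (two_pentagons l) = 11.
Proof.
by rewrite size_monicM ?monicXnsubC // -?size_poly_eq0 !size_XnsubC.
Qed.

Lemma binary_form_two_pentagons l s t :
  binary_form 4 (two_pentagons l) s t = (t ^+ 5 - s ^+ 5) * (t ^+ 5 - l * s ^+ 5).
Proof.
rewrite /binary_form two_pentagonsE !big_ord_recl big_ord0 /=.
rewrite !(coefD, coefN, coefCM, coefXn, coefC) /=.
by rewrite /bump /=; ring.
Qed.

Lemma separable_two_pentagons l : 5 != 0 :> k -> l != 0 -> l != 1 ->
  coprimep (two_pentagons l) (two_pentagons l)^`().
Proof.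
move=> five0 l0 l1; apply: Pdiv.ClosedField.root_coprimep => x.
rewrite /root horner_two_pentagons mulf_eq0 !subr_eq0 => rx.
have x0 : x != 0.
  apply: contraTneq rx => ->; rewrite expr0n /= negb_or !(eq_sym 0) oner_neq0.
  by rewrite l0.
have -> : (two_pentagons l)^`().[x] = 5 * x ^+ 4 * ((x ^+ 5 - 1) + (x ^+ 5 - l)).
  rewrite derivM !derivB !derivXn -polyC1 !derivC !subr0.
  rewrite hornerD !hornerM hornerMn hornerXn !hornerD !hornerN !hornerC hornerXn.
  by rewrite /= -mulr_natl; ring.
by case/orP: rx => /eqP->; rewrite subrr ?addr0 ?add0r;
  rewrite !mulf_neq0 ?expf_neq0 // subr_eq0 // eq_sym.
Qed.

(** The coefficients of the pullback of two_pentagons l under the substitution of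
    (b0 + b1 x) / (a0 + a1 x) for x, with denominators cleared. *)
Definition pentagons_pullback_coefs l (a0 a1 b0 b1 : k) : seq k :=
  [:: l * (a0 ^+ 10)
      - (1 + l) * (a0 ^+ 5 * b0 ^+ 5)
      + b0 ^+ 10;
      l * (10 * a0 ^+ 9 * a1)
      - (1 + l) * (5 * a0 ^+ 5 * b0 ^+ 4 * b1 + 5 * a0 ^+ 4 * a1 * b0 ^+ 5)
      + 10 * b0 ^+ 9 * b1;
      l * (45 * a0 ^+ 8 * a1 ^+ 2)
      - (1 + l) * (10 * a0 ^+ 5 * b0 ^+ 3 * b1 ^+ 2 + 25 * a0 ^+ 4 * a1 * b0 ^+ 4 * b1 +
         10 * a0 ^+ 3 * a1 ^+ 2 * b0 ^+ 5)
      + 45 * b0 ^+ 8 * b1 ^+ 2;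
      l * (120 * a0 ^+ 7 * a1 ^+ 3)
      - (1 + l) * (10 * a0 ^+ 5 * b0 ^+ 2 * b1 ^+ 3 +
         50 * a0 ^+ 4 * a1 * b0 ^+ 3 * b1 ^+ 2 +
         50 * a0 ^+ 3 * a1 ^+ 2 * b0 ^+ 4 * b1 +
         10 * a0 ^+ 2 * a1 ^+ 3 * b0 ^+ 5)
      + 120 * b0 ^+ 7 * b1 ^+ 3;
      l * (210 * a0 ^+ 6 * a1 ^+ 4)
      - (1 + l) * (5 * a0 ^+ 5 * b0 * b1 ^+ 4 + 50 * a0 ^+ 4 * a1 * b0 ^+ 2 * b1 ^+ 3 +
         100 * a0 ^+ 3 * a1 ^+ 2 * b0 ^+ 3 * b1 ^+ 2 +
         50 * a0 ^+ 2 * a1 ^+ 3 * b0 ^+ 4 * b1 + 5 * a0 * a1 ^+ 4 * b0 ^+ 5)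
      + 210 * b0 ^+ 6 * b1 ^+ 4;
      l * (252 * a0 ^+ 5 * a1 ^+ 5)
      - (1 + l) * (a0 ^+ 5 * b1 ^+ 5 + 25 * a0 ^+ 4 * a1 * b0 * b1 ^+ 4 +
         100 * a0 ^+ 3 * a1 ^+ 2 * b0 ^+ 2 * b1 ^+ 3 +
         100 * a0 ^+ 2 * a1 ^+ 3 * b0 ^+ 3 * b1 ^+ 2 +
         25 * a0 * a1 ^+ 4 * b0 ^+ 4 * b1 + a1 ^+ 5 * b0 ^+ 5)
      + 252 * b0 ^+ 5 * b1 ^+ 5;
      l * (210 * a0 ^+ 4 * a1 ^+ 6)
      - (1 + l) * (5 * a0 ^+ 4 * a1 * b1 ^+ 5 + 50 * a0 ^+ 3 * a1 ^+ 2 * b0 * b1 ^+ 4 +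
         100 * a0 ^+ 2 * a1 ^+ 3 * b0 ^+ 2 * b1 ^+ 3 +
         50 * a0 * a1 ^+ 4 * b0 ^+ 3 * b1 ^+ 2 + 5 * a1 ^+ 5 * b0 ^+ 4 * b1)
      + 210 * b0 ^+ 4 * b1 ^+ 6;
      l * (120 * a0 ^+ 3 * a1 ^+ 7)
      - (1 + l) * (10 * a0 ^+ 3 * a1 ^+ 2 * b1 ^+ 5 +
         50 * a0 ^+ 2 * a1 ^+ 3 * b0 * b1 ^+ 4 +
         50 * a0 * a1 ^+ 4 * b0 ^+ 2 * b1 ^+ 3 +
         10 * a1 ^+ 5 * b0 ^+ 3 * b1 ^+ 2)
      + 120 * b0 ^+ 3 * b1 ^+ 7;
      l * (45 * a0 ^+ 2 * a1 ^+ 8)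
      - (1 + l) * (10 * a0 ^+ 2 * a1 ^+ 3 * b1 ^+ 5 + 25 * a0 * a1 ^+ 4 * b0 * b1 ^+ 4 +
         10 * a1 ^+ 5 * b0 ^+ 2 * b1 ^+ 3)
      + 45 * b0 ^+ 2 * b1 ^+ 8;
      l * (10 * a0 * a1 ^+ 9)
      - (1 + l) * (5 * a0 * a1 ^+ 4 * b1 ^+ 5 + 5 * a1 ^+ 5 * b0 * b1 ^+ 4)
      + 10 * b0 * b1 ^+ 9;
      l * (a1 ^+ 10)
      - (1 + l) * (a1 ^+ 5 * b1 ^+ 5)
      + b1 ^+ 10].

Lemma pentagons_pullbackE l (a0 a1 b0 b1 : k) :
  let u := a0%:P + a1%:P * 'X in let v := b0%:P + b1%:P * 'X in
  (v ^+ 5 - u ^+ 5) * (v ^+ 5 - l%:P * u ^+ 5)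
    = \poly_(i < 11) (pentagons_pullback_coefs l a0 a1 b0 b1)`_i.
Proof.
move=> u v; rewrite poly_def !big_ord_recl big_ord0 /= /bump /= -!mul_polyC.
by rewrite /u /v; ring.
Qed.

(** The hypotheses say that A (1 + x)^10 + B (1 + x)^5 (1 + e x)^5
    + C (1 + e x)^10 has no terms in x, x^2, x^3, x^4. The first three equations
    are linear in A, B, C with determinant 30 e (e - 1)^3 (e + 1), whose expansion
    along the column of C provides the multipliers below. This leaves e = -1,
    which the fourth equation excludes. *)
Lemma no_transverse_pullback (A B C e : k) :
    2 != 0 :> k -> 3 != 0 :> k -> 5 != 0 :> k -> e != 0 -> e != 1 ->
    2 * A + B * (1 + e) + 2 * e * C = 0 ->
    9 * A + B * (2 + 5 * e + 2 * e ^+ 2) + 9 * e ^+ 2 * C = 0 ->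
    12 * A + B * (1 + 5 * e + 5 * e ^+ 2 + e ^+ 3) + 12 * e ^+ 3 * C = 0 ->
    42 * A + B * (1 + 10 * e + 20 * e ^+ 2 + 10 * e ^+ 3 + e ^+ 4)
      + 42 * e ^+ 4 * C = 0 ->
  C = 0.
Proof.
move=> two0 three0 five0 e0 e1 H1 H2 H3 H4.
have en1 : e - 1 != 0 by rewrite subr_eq0.
have /eqP : 2 * 3 * 5 * e * (e - 1) ^+ 3 * (e + 1) * C = 0.
  transitivity (
    (9 * e ^+ 3 + 21 * e ^+ 2 - 15 * e - 15)
      * (2 * A + B * (1 + e) + 2 * e * C)
    + (- 2 * e ^+ 3 - 10 * e ^+ 2 + 2 * e + 10)
      * (9 * A + B * (2 + 5 * e + 2 * e ^+ 2) + 9 * e ^+ 2 * C)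
    + (4 * e ^+ 2 + e - 5)
      * (12 * A + B * (1 + 5 * e + 5 * e ^+ 2 + e ^+ 3) + 12 * e ^+ 3 * C)).
    by ring.
  by rewrite H1 H2 H3 !mulr0 !addr0.
rewrite !mulf_eq0 (negPf two0) (negPf three0) (negPf five0) (negPf e0).
rewrite (negPf en1) /= => /orP[|/eqP //].
rewrite addr_eq0 => /eqP e1'; move: H1 H2 H4; rewrite e1' => H1 H2 H4.
have /eqP : 2 * 2 * 2 * 3 * 5 * C = 0.
  transitivity ((42 * A + B * (1 + 10 * -1 + 20 * (-1) ^+ 2 + 10 * (-1) ^+ 3
      + (-1) ^+ 4) + 42 * (-1) ^+ 4 * C)
    + 2 * (9 * A + B * (2 + 5 * -1 + 2 * (-1) ^+ 2) + 9 * (-1) ^+ 2 * C)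
    - 30 * (2 * A + B * (1 + -1) + 2 * -1 * C)); first by ring.
  by rewrite H1 H2 H4; ring.
by rewrite !mulf_eq0 (negPf two0) (negPf three0) (negPf five0) => /eqP.
Qed.

Lemma mobius_two_pentagons l1 l2 (a0 a1 b0 b1 : k) :
    2 != 0 :> k -> 3 != 0 :> k -> 5 != 0 :> k ->
    l1 != 0 -> l1 != 1 -> l2 != 0 -> a1 * b0 - a0 * b1 != 0 ->
    (forall x, (two_pentagons l1).[x] = 0 ->
       binary_form 4 (two_pentagons l2) (a0 + a1 * x) (b0 + b1 * x) = 0) ->
  l1 = l2 \/ l1 = 1 / l2.
Proof.
move=> two0 three0 five0 l10 l11 l20 det branch.
have ten0 : 10 != 0 :> k.
  by rewrite (_ : 10 = 2 * 5) ?mulf_neq0 // -natrM.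
pose P := \poly_(i < 11) (pentagons_pullback_coefs l2 a0 a1 b0 b1)`_i.
have PE x : P.[x] = binary_form 4 (two_pentagons l2) (a0 + a1 * x) (b0 + b1 * x).
  rewrite /P -pentagons_pullbackE binary_form_two_pentagons.
  by rewrite !(hornerD, hornerN, hornerM, horner_exp, hornerC, hornerX).
have [rs Ers] := closed_field_poly_normal (two_pentagons l1).
rewrite (monicP (two_pentagons_monic l1)) scale1r in Ers.
have rs_root x : x \in rs -> (two_pentagons l1).[x] = 0.
  by rewrite -root_prod_XsubC -Ers => /eqP.
have /dvdpP[q Eq] : two_pentagons l1 %| P.
  rewrite Ers; apply: uniq_roots_dvdp.
    by apply/allP => x /rs_root/branch Fx; rewrite /root PE Fx.
  rewrite uniq_rootsE -separable_prod_XsubC -Ers.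
  by rewrite unlock separable_two_pentagons.
have /size1_polyC Ec : (size q <= 1)%N.
  have [-> | q0] := eqVneq q 0; first by rewrite size_poly0.
  have : (size P <= 11)%N by apply: size_poly.
  rewrite Eq size_Mmonic ?two_pentagons_monic // size_two_pentagons addnS /=.
  by rewrite -(leq_add2r 10 (size q) 1).
set c := q`_0 in Ec.
have coefE i : (i < 11)%N ->
    (pentagons_pullback_coefs l2 a0 a1 b0 b1)`_i = c * (two_pentagons l1)`_i.
  by move=> lt_i; rewrite -coefCM -Ec -Eq coef_poly lt_i.
have := (coefE 0%N isT, coefE 1%N isT, coefE 2%N isT, coefE 3%N isT, coefE 4%N isT,
  coefE 9%N isT, coefE 10%N isT).
rewrite two_pentagonsE !(coefD, coefN, coefCM, coefXn, coefC) /=.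
rewrite !(mulr0, mulr1, oppr0, addr0, add0r).
case=> -[[[[[E0 E1] E2] E3] E4] E9] E10.
have P1 : P.[1] = 0 by rewrite Eq hornerM horner_two_pentagons expr1n subrr mul0r mulr0.
move: P1; rewrite PE binary_form_two_pentagons !mulr1 => P1.
(* The scaling x |-> q x, with q^5 = b1^5 / a0^5 equal to 1 or l2. *)
have scaling : a1 = 0 -> b0 = 0 -> l1 = l2 \/ l1 = 1 / l2.
  move=> a10 b00; rewrite a10 b00 in det E0 E10 P1.
  have a00 : a0 != 0 by apply: contraNneq det => ->; rewrite mulr0 mul0r subrr.
  have Ec' : c = (b1 ^+ 5) ^+ 2 by rewrite -E10; ring.
  have {}E0 : l2 * (a0 ^+ 5) ^+ 2 = c * l1 by rewrite -E0; ring.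
  have /eqP : (b1 ^+ 5 - a0 ^+ 5) * (b1 ^+ 5 - l2 * a0 ^+ 5) = 0 by rewrite -P1; ring.
  rewrite Ec' in E0; rewrite mulf_eq0 !subr_eq0.
  have U0 : (a0 ^+ 5) ^+ 2 != 0 by rewrite !expf_neq0.
  case/orP=> /eqP EV; rewrite EV in E0; [left | right].
    by apply: (mulfI U0); rewrite -E0 mulrC.
  apply: (mulfI (mulf_neq0 l20 U0)); apply: (mulfI l20).
  by rewrite mulrA; transitivity ((l2 * a0 ^+ 5) ^+ 2 * l1); [ring | rewrite -E0; field].
(* The inversion x |-> q / x, with q^5 = b0^5 / a1^5 equal to 1 or l2. *)
have inversion : a0 = 0 -> b1 = 0 -> l1 = l2 \/ l1 = 1 / l2.
  move=> a00 b10; rewrite a00 b10 in det E0 E10 P1.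
  have a10 : a1 != 0 by apply: contraNneq det => ->; rewrite !mul0r subrr.
  have Ec' : c = l2 * (a1 ^+ 5) ^+ 2 by rewrite -E10; ring.
  have {}E0 : (b0 ^+ 5) ^+ 2 = c * l1 by rewrite -E0; ring.
  have /eqP : (b0 ^+ 5 - a1 ^+ 5) * (b0 ^+ 5 - l2 * a1 ^+ 5) = 0 by rewrite -P1; ring.
  rewrite Ec' in E0; rewrite mulf_eq0 !subr_eq0.
  have U0 : (a1 ^+ 5) ^+ 2 != 0 by rewrite !expf_neq0.
  case/orP=> /eqP EV; rewrite EV in E0; [right | left].
    by apply: (mulfI (mulf_neq0 l20 U0)); rewrite -E0; field.
  by apply: (mulfI (mulf_neq0 l20 U0)); rewrite -E0; ring.
have kill (n : nat) (x y d : k) : x != 0 -> d != 0 -> x ^+ n * (d * y) = 0 -> y = 0.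
  move=> x0 d0 /eqP; rewrite !mulf_eq0 (negPf d0) expf_eq0 (negPf x0) andbF.
  by move/eqP.
have [a10|a10] := eqVneq a1 0.
  rewrite a10 in det E9; apply: (scaling a10).
  have b10 : b1 != 0 by apply: contraNneq det => ->; rewrite mulr0 mul0r subrr.
  by apply: (kill 9 b1 _ 10 b10 ten0); rewrite -E9; ring.
have [b10|b10] := eqVneq b1 0.
  rewrite b10 in det E9; apply: inversion b10.
  by apply: (kill 9 a1 _ (l2 * 10) a10 (mulf_neq0 l20 ten0)); rewrite -E9; ring.
have [a00|a00] := eqVneq a0 0.
  rewrite a00 in det E1; apply: (inversion a00).
  have b00 : b0 != 0 by apply: contraNneq det => ->; rewrite mulr0 mul0r subrr.
  by apply: (kill 9 b0 _ 10 b00 ten0); rewrite -E1; ring.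
have [b00|b00] := eqVneq b0 0.
  rewrite b00 in E1; apply: scaling b00.
  by apply: (kill 9 a0 _ (l2 * 10) a00 (mulf_neq0 l20 ten0)); rewrite -E1; ring.
(* Up to constants, u = 1 + d x and v = 1 + e d x; then x is rescaled by d. *)
pose d := a1 / a0; pose e := b1 / (b0 * d).
have d0 : d != 0 by rewrite mulf_neq0 ?invr_eq0.
have Ea : a1 = d * a0 by rewrite divfK.
have Eb : b1 = e * d * b0 by rewrite -mulrA [d * _]mulrC divfK // mulf_neq0.
have e0 : e != 0 by rewrite mulf_neq0 // invr_eq0 mulf_neq0.
have e1 : e != 1.
  by apply: contraNneq det => e1; rewrite Eb Ea e1; apply/eqP; ring.
rewrite Ea Eb in E1 E2 E3 E4.
have : b0 ^+ 10 = 0.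
  apply: (@no_transverse_pullback (l2 * a0 ^+ 10) (- (1 + l2) * (a0 ^+ 5 * b0 ^+ 5)) _ e)
    => //.
  - by apply: (kill 1 d _ 5 d0 five0); rewrite -E1; ring.
  - by apply: (kill 2 d _ 5 d0 five0); rewrite -E2; ring.
  - by apply: (kill 3 d _ 10 d0 ten0); rewrite -E3; ring.
  by apply: (kill 4 d _ 5 d0 five0); rewrite -E4; ring.
by move/eqP; rewrite expf_eq0 (negPf b00).
Qed.

End TwoPentagons.

(** * The isomorphism exchanging zero and infinity *)

Section Swap.
Variable k : fieldType.

Lemma isomorphic_refl n (X : projset k n) : isomorphic X X.
Proof.
have eX (v : 'rV[k]_n.+1) : eval_tuple (fun i => 'X_i) v = v.
  by apply/rowP => i; rewrite mxE mevalXU.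
have mor : is_morphism X X id.
  split=> // P _; exists 1%N, (fun i => 'X_i); split=> [i|v [v0 _]|Q v _ Qv _].
  - by rewrite dhomogX /= mdeg1.
  - by rewrite eX.
  by rewrite eX.
by exists id, id; split.
Qed.

Variable g : nat.
Local Notation E := (weighted_coords g).

Let flip (i : 'I_g.+3) : 'I_g.+3 := if (i <= g.+1)%N then inord (g.+1 - i) else i.

Let swap (m : k) (v : 'rV[k]_g.+3) : 'rV[k]_g.+3 :=
  \row_i ((if (i <= g.+1)%N then 1 else m) * v 0 (flip i)).

Let swap_weighted m s t y : swap m (E s t y) = E t s (m * y).
Proof.
apply/rowP => i; rewrite !mxE /flip; case: leqP => [le_i|gt_i].
  rewrite inordK; last by rewrite ltnS (leq_trans (leq_subr _ _)).
  by rewrite leq_subr subKn // mul1r mulrC.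
by rewrite leqNgt gt_i.
Qed.

Let swap_scale m c v : swap m (c *: v) = c *: swap m v.
Proof. by apply/rowP => i; rewrite !mxE mulrCA. Qed.

Let swap_point m (P : projspace k g.+2) := point (swap m (vpick (val P))).

Let swap_pointE m P s t y : (s != 0) || (t != 0) -> val P = <[E s t y]>%VS ->
  val (swap_point m P) = <[E t s (m * y)]>%VS.
Proof.
move=> st EP; have [c c0 Ev] := homog_coords_scale (vpick_homog_coords P) EP.
rewrite /swap_point Ev swap_scale swap_weighted val_point ?line_scale //.
by rewrite scaler_eq0 negb_or c0 weighted_neq0 // orbC.
Qed.

Let swap_morphism (f1 f2 : {poly k}) m :
    (forall s t, m ^+ 2 * binary_form g f1 s t = binary_form g f2 t s) ->
  is_morphism (hyperelliptic g f1) (hyperelliptic g f2) (swap_point m).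
Proof.
move=> Ef.
have eS v : eval_tuple (fun i : 'I_g.+3 =>
    (if (i <= g.+1)%N then 1 else m) *: 'X_(flip i)) v = swap m v.
  by apply/rowP => i; rewrite !mxE mevalZ mevalXU.
have hE P v : hyperelliptic g f1 P -> homog_coords P v ->
    swap m v != 0 /\ homog_coords (swap_point m P) (swap m v).
  case/hyperellipticP=> s [t [y [st Ey EP]]] /homog_coords_scale/(_ EP)[c c0 ->].
  rewrite swap_scale swap_weighted.
  have n0 : c *: E t s (m * y) != 0.
    by rewrite scaler_eq0 negb_or c0 weighted_neq0 // orbC.
  split=> //; apply: homog_coords_line => //.
  by rewrite (swap_pointE _ st EP) line_scale.
split=> [P /hyperellipticP[s [t [y [st Ey EP]]]]|P XP].
  apply/hyperellipticP; exists t, s, (m * y); split; first by rewrite orbC.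
    by rewrite exprMn Ey Ef.
  exact: swap_pointE.
exists 1%N, (fun i : 'I_g.+3 => (if (i <= g.+1)%N then 1 else m) *: 'X_(flip i)); split.
- by move=> i; apply/dhomogZ; rewrite dhomogX /= mdeg1.
- by move=> v /(hE _ _ XP)[]; rewrite eS.
by move=> Q v XQ /(hE _ _ XQ)[]; rewrite eS.
Qed.

(** The isomorphism is (x, y) |-> (1 / x, m y / x^(g+1)); on the projective model it
    reverses the order of the coordinates x^i and multiplies y by m. *)
Lemma swap_isomorphic (f1 f2 : {poly k}) m : m != 0 ->
    (forall s t, m ^+ 2 * binary_form g f1 s t = binary_form g f2 t s) ->
  isomorphic (hyperelliptic g f1) (hyperelliptic g f2).
Proof.
move=> m0 Ef; exists (swap_point m), (swap_point m^-1).
have swapK (f : {poly k}) (m1 m2 : k) : m2 * m1 = 1 -> forall P, hyperelliptic g f P ->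
    swap_point m2 (swap_point m1 P) = P.
  move=> m12 P /hyperellipticP[s [t [y [st Ey EP]]]]; apply/val_inj.
  have E1 := swap_pointE m1 st EP; rewrite orbC in st.
  by rewrite (swap_pointE m2 st E1) mulrA m12 mul1r EP.
split; first exact: swap_morphism.
- by apply: swap_morphism => s t; rewrite -Ef exprVn mulKf ?expf_neq0.
- by apply: swapK; rewrite mulVf.
by apply: swapK; rewrite divff.
Qed.

End Swap.

(** * The isomorphism criterion *)

Theorem proposition3p3p4 (k : closedFieldType) (p : nat)
    (hchar : p \in [pchar k]) (hp : (7 <= p)%N)
    (lambda1 lambda2 : k)
    (hl10 : lambda1 != 0) (hl11 : lambda1 != 1)
    (hl20 : lambda2 != 0) (hl21 : lambda2 != 1) :
  isomorphic (Hprime lambda1) (Hprime lambda2) <->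
  lambda1 = lambda2 \/ lambda1 = 1 / lambda2.
Proof.
have small n : (0 < n < 7)%N -> n%:R != 0 :> k.
  move=> /andP[n0 n7]; rewrite -(dvdn_pcharf hchar) gtnNdvd //.
  exact: leq_trans hp.
have two0 : 2 != 0 :> k := small 2%N isT.
have five0 : 5 != 0 :> k := small 5%N isT.
split=> [[phi [psi [phi_mor psi_mor phiK psiK]]]|[->|El]].
- have [a0 [a1 [b0 [b1 [det branch]]]]] := branch_points_correspond two0 (isT : 2 <= 4)%N
    (size_two_pentagons lambda1) (separable_two_pentagons five0 hl10 hl11)
    (size_two_pentagons lambda2)
    phi_mor psi_mor phiK psiK.
  exact: (mobius_two_pentagons two0 (small 3%N isT) five0 hl10 hl11 hl20 det branch).
- exact: isomorphic_refl.
have [m Em] := exists_sqrt lambda2.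
apply: (@swap_isomorphic k 4 _ _ m) => [|s t].
  by apply: contraNneq hl20 => m0; rewrite -Em m0 expr0n.
rewrite -/(two_pentagons lambda1) -/(two_pentagons lambda2).
by rewrite !binary_form_two_pentagons Em El; field.
Qed.
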